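(* There are no completely Bertrand pseudo-Riemannian systems. That is: let $S=(a,b)\times S^1$ with coordinates $(r,\varphi \bmod 2\pi)$, $r\in(a,b)$, be endowed with the pseudo-Riemannian metric $ds^2=dr^2-f^2(r)\,d\varphi^2$, where $f$ is a smooth function without zeros on $(a,b)$, and let $V=V(r)$ be a smooth function on $(a,b)$. Then the potential $V$ is not completely closing on $(S,ds^2)$, i.e. not all nonsingular orbits of the natural mechanical system on $(S,ds^2)$ with potential $V$ are closed. (This holds whether or not $f'$ has zeros on $(a,b)$.)
   Context: The natural mechanical system on $(S,ds^2)$ with central potential $V(r)$ is the Lagrangian system with Lagrangian $\frac12(\dot r^2-f^2(r)\dot\varphi^2)-V(r)$. Its energy $H=\frac12(\dot r^2-f^2(r)\dot\varphi^2)+V(r)$ and its kinetic moment $K=-f^2(r)\dot\varphi$ are constant along every trajectory. A trajectory is a solution $x(t)=(r(t),\varphi(t))$ of the equations of motion defined on its maximal interval $(t_0,t_1)\subset\mathbb{R}$. The corresponding orbit is the image $\{x(t)\mid t\in(t_0,t_1)\}\subset S$. A trajectory (and its orbit) is singular if its value of $K$ is zero (equivalently $\varphi=\mathrm{const}$), and nonsingular otherwise. A nonsingular orbit is closed if it is a closed curve, i.e. the trajectory is defined for all $t\in\mathbb{R}$ and is periodic in $t$ as a curve in $S$. The potential $V$ is called completely closing if all nonsingular orbits are closed; here all nonsingular trajectories are meant, with no restriction on the causal type (spacelike, timelike, lightlike) of their velocity. The triple $(S,ds^2,V)$ is then called a completely Bertrand system. A zero of $f'$ is called an equator of $S$; equators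 are allowed. *)

(* Defs.v *)
From Stdlib Require Import Reals ZArith.
From Coquelicot Require Import Coquelicot.
Open Scope R_scope.

(* Endpoints are taken in [Rbar], so that the interval may be unbounded. *)
Definition in_interval (a b : Rbar) (x : R) : Prop := Rbar_lt a x /\ Rbar_lt x b.

Definition smooth_on (a b : Rbar) (g : R -> R) : Prop :=
  forall (n : nat) (x : R), in_interval a b x -> ex_derive_n g n x.

(* A point of S = (a,b) x S^1 is given by (r, phi) with r in (a,b) and phi in R,
   phi being taken modulo 2 PI. *)
Definition same_point (r phi r' phi' : R) : Prop :=
  r = r' /\ exists k : Z, phi' = phi + 2 * PI * IZR k.

(* The metric dr^2 - f^2(r) dphi^2 at (r, phi), evaluated on the tangent vector
   (vr, vphi). *)
Definition metric (f : R -> R) (r phi vr vphi : R) : R :=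
  vr ^ 2 - f r ^ 2 * vphi ^ 2.

Definition lagrangian (f V : R -> R) (r phi vr vphi : R) : R :=
  / 2 * metric f r phi vr vphi - V r.

(* d/dt (dL/dvr) = dL/dr  and  d/dt (dL/dvphi) = dL/dphi  at time t, along the
   curve s |-> (r s, phi s). *)
Definition euler_lagrange (L : R -> R -> R -> R -> R) (r phi : R -> R) (t : R)
  : Prop :=
  is_derive
    (fun s => Derive (fun v => L (r s) (phi s) v (Derive phi s)) (Derive r s))
    t (Derive (fun q => L q (phi t) (Derive r t) (Derive phi t)) (r t))
  /\
  is_derive
    (fun s => Derive (fun v => L (r s) (phi s) (Derive r s) v) (Derive phi s))
    t (Derive (fun q => L (r t) q (Derive r t) (Derive phi t)) (phi t)).

(* The curve is given by a continuous lift of its angular coordinate to R; the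
   values of [r] and [phi] outside (t0, t1) are irrelevant. *)
Definition is_solution (a b : Rbar) (f V : R -> R)
    (t0 t1 : Rbar) (r phi : R -> R) : Prop :=
  Rbar_lt t0 t1 /\
  forall t : R, in_interval t0 t1 t ->
    in_interval a b (r t) /\ ex_derive r t /\ ex_derive phi t /\
    euler_lagrange (lagrangian f V) r phi t.

Definition is_trajectory (a b : Rbar) (f V : R -> R)
    (t0 t1 : Rbar) (r phi : R -> R) : Prop :=
  is_solution a b f V t0 t1 r phi /\
  forall (s0 s1 : Rbar) (r' phi' : R -> R),
    is_solution a b f V s0 s1 r' phi' ->
    Rbar_le s0 t0 -> Rbar_le t1 s1 ->
    (forall t : R, in_interval t0 t1 t -> r' t = r t /\ phi' t = phi t) ->
    s0 = t0 /\ s1 = t1.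

Definition kinetic_moment (f : R -> R) (r phi : R -> R) (t : R) : R :=
  - f (r t) ^ 2 * Derive phi t.

(* The kinetic moment is constant along a trajectory. *)
Definition singular (f : R -> R) (t0 t1 : Rbar) (r phi : R -> R) : Prop :=
  forall t : R, in_interval t0 t1 t -> kinetic_moment f r phi t = 0.

Definition closed_orbit (t0 t1 : Rbar) (r phi : R -> R) : Prop :=
  t0 = m_infty /\ t1 = p_infty /\
  exists T : R, 0 < T /\
    forall t : R, same_point (r t) (phi t) (r (t + T)) (phi (t + T)).

Definition completely_closing (a b : Rbar) (f V : R -> R) : Prop :=
  forall (t0 t1 : Rbar) (r phi : R -> R),
    is_trajectory a b f V t0 t1 r phi ->
    ~ singular f t0 t1 r phi ->
    closed_orbit t0 t1 r phi.

(* Main.v *)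
Require Import Defs.
From Stdlib Require Import Reals.
From Coquelicot Require Import Coquelicot.
From Stdlib Require Import Lra Lia ZArith List Classical IndefiniteDescription.
Open Scope R_scope.

(** With kinetic moment [K] the radial coordinate moves in the effective
    potential [V - K^2 / (2 f^2)], which is everywhere below [V].

    If [V] has no well, it is bounded above on one side of some point; then so is
    the effective potential, and some orbit either crosses the whole surface
    monotonically or comes from the boundary, is reflected once and returns; it
    is not periodic.

    If [V] has a well, Sard's theorem provides one whose turning points are not
    critical. It persists in the effective potential for small [K], and the angle
    swept during one radial period depends continuously on [K] and is nonzero,
    but tends to [0] with [K]: no centrifugal barrier keeps it away from [0]. So
    it takes values that are not rational multiples of [2 PI], and the
    corresponding orbits do not close.

    All radial motions are written as [r = rho (u t)], where [rho] is an explicit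
    function with folds at the turning points and [u] solves an equation
    [u' = g u] with [g > 0], which is integrated by separation of variables. *)

(** * Intervals and continuity *)

(** The closing property speaks of maximal trajectories, whereas only explicit solutions are
    constructed. A solution on the whole time line is maximal at once; for the others maximality
    follows from leaving every compact part of [(a, b)] at both ends of time.

    The obstacle in the radial equation is the turning point: [r' = sqrt (2 * (E - W r))] vanishes
    there, so variables cannot be separated in [r]. Along a fold [rho], the square of the derivative
    of [rho] vanishes to the same order as [E - W (rho u)]. Their quotient determines [g ^ 2]; it is
    a divided difference of [W], and it stays positive at a turning point that is not critical.
    Hence the appeal to Sard. The price is that [g] is merely continuous, so the acceleration has to
    be recovered from the energy.

    For oscillations the left turning point [r1] is kept fixed by letting the energy vary with [K]:
    it is the value of the effective potential at [r1]. Only the right turning point moves, and the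
    equation relating it to [K] is linear in [K ^ 2]. *)

Lemma in_interval_locally (a b : Rbar) (x : R) :
  in_interval a b x -> locally x (in_interval a b).
Proof.
  intros [ha hb]. apply (locally_interval _ x a b ha hb).
  intros y h1 h2. split; assumption.
Qed.

Lemma in_interval_between (a b : Rbar) (x y z : R) :
  in_interval a b x -> in_interval a b y -> x <= z <= y -> in_interval a b z.
Proof.
  intros [ha _] [_ hb] [h1 h2]. split.
  - eapply Rbar_lt_le_trans; [exact ha | exact h1].
  - eapply Rbar_le_lt_trans; [| exact hb]; exact h2.
Qed.

Lemma in_interval_minmax (a b : Rbar) (x y z : R) :
  in_interval a b x -> in_interval a b y -> Rmin x y <= z <= Rmax x y ->
  in_interval a b z.
Proof.
  intros hx hy hz. unfold Rmin, Rmax in hz.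
  destruct (Rle_dec x y).
  - exact (in_interval_between a b x y z hx hy hz).
  - exact (in_interval_between a b y x z hy hx hz).
Qed.

Lemma in_interval_below (a b : Rbar) (x : R) :
  in_interval a b x -> exists y, in_interval a b y /\ y < x.
Proof.
  intros h. destruct (in_interval_locally a b x h) as [d hd].
  exists (x - d / 2). destruct d as [d d0]; simpl in *. split; [| lra].
  apply hd. unfold ball; simpl; unfold AbsRing_ball, abs, minus, plus, opp; simpl.
  rewrite Rabs_left; lra.
Qed.

Lemma in_interval_above (a b : Rbar) (x : R) :
  in_interval a b x -> exists y, in_interval a b y /\ x < y.
Proof.
  intros h. destruct (in_interval_locally a b x h) as [d hd].
  exists (x + d / 2). destruct d as [d d0]; simpl in *. split; [| lra].
  apply hd. unfold ball; simpl; unfold AbsRing_ball, abs, minus, plus, opp; simpl.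
  rewrite Rabs_right; lra.
Qed.

Lemma in_interval_nonempty (a b : Rbar) :
  Rbar_lt a b -> exists x : R, in_interval a b x.
Proof.
  unfold in_interval. destruct a as [a| |], b as [b| |]; simpl; intros h;
    try contradiction.
  - exists ((a + b) / 2). lra.
  - exists (a + 1). split; [lra | trivial].
  - exists (b - 1). split; [trivial | lra].
  - exists 0. split; trivial.
Qed.

Lemma in_interval_opp (a b : Rbar) (x : R) :
  in_interval (Rbar_opp b) (Rbar_opp a) (- x) <-> in_interval a b x.
Proof.
  unfold in_interval. destruct a as [a| |], b as [b| |]; simpl;
    split; intros [h1 h2]; split; trivial; lra.
Qed.

Lemma is_derive_continuous (g : R -> R) (x l : R) :
  is_derive g x l -> continuous g x.
Proof. intros h. apply (ex_derive_continuous g). exists l. exact h. Qed.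

Lemma locally_Rabs (P : R -> Prop) (x : R) :
  locally x P <-> exists d, 0 < d /\ forall y, Rabs (y - x) < d -> P y.
Proof.
  split.
  - intros [d hd]. exists d. split; [apply cond_pos | exact hd].
  - intros [d [hd h]]. exists (mkposreal d hd). exact h.
Qed.

Lemma continuous_eps (g : R -> R) (x : R) :
  continuous g x <->
  forall eps, 0 < eps -> exists d, 0 < d /\
    forall y, Rabs (y - x) < d -> Rabs (g y - g x) < eps.
Proof.
  split.
  - intros h eps he. apply locally_Rabs.
    apply (h (fun z => Rabs (z - g x) < eps)). apply locally_Rabs.
    exists eps. split; [exact he | trivial].
  - intros h P [eps hP]. destruct (h eps (cond_pos eps)) as [d [hd hg]].
    apply locally_Rabs. exists d. split; [exact hd |].
    intros y hy. apply hP, hg, hy.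
Qed.

Lemma continuous_positive_locally (g : R -> R) (x : R) :
  continuous g x -> 0 < g x -> locally x (fun y => 0 < g y).
Proof.
  intros hg hp. apply (hg (fun z => 0 < z)).
  apply (locally_interval _ (g x) 0 p_infty); simpl; trivial.
Qed.

Lemma mean_value (a b : Rbar) (g dg : R -> R) (x y : R) :
  (forall z, in_interval a b z -> is_derive g z (dg z)) ->
  in_interval a b x -> in_interval a b y ->
  exists z, Rmin x y <= z <= Rmax x y /\ g y - g x = dg z * (y - x).
Proof.
  intros hg hx hy. apply MVT_gen.
  - intros z hz. apply hg. apply (in_interval_minmax a b x y); trivial; lra.
  - intros z hz. apply continuity_pt_filterlim.
    apply (is_derive_continuous g z (dg z)), hg.
    apply (in_interval_minmax a b x y); trivial.
Qed.

Lemma Rabs_between (x y z : R) : Rmin x y <= z <= Rmax x y -> Rabs (z - x) <= Rabs (y - x).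
Proof.
  unfold Rmin, Rmax. destruct (Rle_dec x y); intros h.
  - rewrite !Rabs_right; lra.
  - rewrite !Rabs_left1; lra.
Qed.

Lemma ivt_interval (a b : Rbar) (g : R -> R) (x y e : R) :
  (forall z, in_interval a b z -> continuous g z) ->
  in_interval a b x -> in_interval a b y -> x <= y ->
  g x < e < g y \/ g y < e < g x -> exists z, x < z < y /\ g z = e.
Proof.
  intros hg hx hy hxy he.
  assert (hne : x <> y) by (intros ->; lra).
  assert (hlt : x < y) by lra.
  assert (hc : forall z, x <= z <= y -> continuity_pt g z).
  { intros z hz. apply continuity_pt_filterlim. apply hg.
    apply (in_interval_between a b x y); trivial. }
  destruct he as [he | he].
  - destruct (Ranalysis5.IVT_interv (fun z => g z - e) x y) as [z [hz hz0]];
      try lra.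
    { intros z hz. apply continuity_pt_minus; [apply hc, hz |].
      apply continuity_pt_const. intros u v. reflexivity. }
    exists z. split; [| lra].
    destruct (Req_dec z x) as [-> |]; [lra |]. destruct (Req_dec z y) as [-> |]; lra.
  - destruct (Ranalysis5.IVT_interv (fun z => e - g z) x y) as [z [hz hz0]];
      try lra.
    { intros z hz. apply continuity_pt_minus; [| apply hc, hz].
      apply continuity_pt_const. intros u v. reflexivity. }
    exists z. split; [| lra].
    destruct (Req_dec z x) as [-> |]; [lra |]. destruct (Req_dec z y) as [-> |]; lra.
Qed.

Lemma antiderivative_interval (a b : Rbar) (g : R -> R) (x0 : R) :
  in_interval a b x0 -> (forall x, in_interval a b x -> continuous g x) ->
  forall x, in_interval a b x -> is_derive (RInt g x0) x (g x).
Proof.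
  intros h0 hg x hx. apply (is_derive_RInt g (RInt g x0) x0 x); [| apply hg, hx].
  apply filter_imp with (2 := in_interval_locally a b x hx).
  intros y hy. apply (RInt_correct g). apply (ex_RInt_continuous g).
  intros z hz. apply hg. apply (in_interval_minmax a b x0 y); trivial.
Qed.

Lemma increasing_of_derive (a b : Rbar) (g dg : R -> R) (x y : R) :
  (forall z, in_interval a b z -> is_derive g z (dg z)) ->
  (forall z, in_interval a b z -> 0 < dg z) ->
  in_interval a b x -> in_interval a b y -> x < y -> g x < g y.
Proof.
  intros hg hp hx hy hxy.
  destruct (mean_value a b g dg x y hg hx hy) as [z [hz heq]].
  assert (0 < dg z) by (apply hp; apply (in_interval_minmax a b x y); trivial).
  assert (0 < dg z * (y - x)) by (apply Rmult_lt_0_compat; lra).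
  lra.
Qed.

Lemma constant_of_derive (a b : Rbar) (g : R -> R) (x y : R) :
  (forall z, in_interval a b z -> is_derive g z 0) ->
  in_interval a b x -> in_interval a b y -> g x = g y.
Proof.
  intros hg hx hy.
  destruct (mean_value a b g (fun _ => 0) x y hg hx hy) as [z [hz heq]]. lra.
Qed.

(* Separation of variables: [G] is the time, [u] its inverse function. *)
Lemma autonomous_flow (al be : Rbar) (g : R -> R) (u0 : R) :
  in_interval al be u0 ->
  (forall x, in_interval al be x -> continuous g x) ->
  (forall x, in_interval al be x -> 0 < g x) ->
  exists (t0 t1 : Rbar) (u G : R -> R),
    G u0 = 0 /\
    (forall x, in_interval al be x ->
       is_derive G x (/ g x) /\ in_interval t0 t1 (G x) /\ u (G x) = x) /\
    (forall t, in_interval t0 t1 t ->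
       in_interval al be (u t) /\ G (u t) = t /\ is_derive u t (g (u t))) /\
    (forall x t, in_interval al be x -> in_interval t0 t1 t ->
       (G x < t -> x < u t) /\ (t < G x -> u t < x)).
Proof.
  intros h0 hc hp.
  set (G := RInt (fun x => / g x) u0).
  assert (hG : forall x, in_interval al be x -> is_derive G x (/ g x)).
  { apply (antiderivative_interval al be (fun x => / g x) u0 h0).
    intros x hx. apply (continuous_comp g Rinv); [apply hc, hx |].
    apply continuous_Rinv. specialize (hp x hx). lra. }
  assert (hp' : forall x, in_interval al be x -> 0 < / g x).
  { intros x hx. apply Rinv_0_lt_compat, hp, hx. }
  assert (hGi : forall x y, in_interval al be x -> in_interval al be y -> x < y ->
                 G x < G y).
  { intros x y. apply (increasing_of_derive al be G (fun x => / g x)); trivial. }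
  assert (hGi' : forall x y, in_interval al be x -> in_interval al be y ->
                 G x < G y -> x < y).
  { intros x y hx hy h. destruct (Rtotal_order x y) as [h1 | [h1 | h1]]; trivial.
    - subst. lra.
    - specialize (hGi y x hy hx h1). lra. }
  (* The end points of the time interval are the bounds of the range of [G], finite or not. They are
     not attained, because [G] is strictly increasing on an open interval. *)
  set (E := fun t => exists x, in_interval al be x /\ G x = t).
  destruct (Lub_Rbar_correct E) as [hub hlub].
  destruct (Glb_Rbar_correct E) as [hlb hglb].
  set (t1 := Lub_Rbar E) in *. set (t0 := Glb_Rbar E) in *.
  assert (hin : forall x, in_interval al be x -> in_interval t0 t1 (G x)).
  { intros x hx. split.
    - destruct (in_interval_below al be x hx) as [y [hy hyx]].
      apply Rbar_le_lt_trans with (G y).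
      + apply hlb. exists y. split; trivial.
      + apply hGi; trivial.
    - destruct (in_interval_above al be x hx) as [y [hy hyx]].
      apply Rbar_lt_le_trans with (G y).
      + apply hGi; trivial.
      + apply hub. exists y. split; trivial. }
  assert (hsurj : forall t, in_interval t0 t1 t ->
            exists x, in_interval al be x /\ G x = t).
  { intros t [ht0 ht1].
    assert (hx : exists x, in_interval al be x /\ G x < t).
    { apply NNPP. intros hn. apply (Rbar_lt_not_le _ _ ht0). apply hglb.
      intros s [x [hx <-]]. simpl. apply Rnot_lt_le. intros hlt.
      apply hn. exists x. split; trivial. }
    assert (hy : exists y, in_interval al be y /\ t < G y).
    { apply NNPP. intros hn. apply (Rbar_lt_not_le _ _ ht1). apply hlub.
      intros s [x [hx' <-]]. simpl. apply Rnot_lt_le. intros hlt.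
      apply hn. exists x. split; trivial. }
    destruct hx as [x [hx hxt]]. destruct hy as [y [hy hyt]].
    assert (hxy : x < y) by (apply hGi'; trivial; lra).
    destruct (ivt_interval al be G x y t) as [z [hz hzt]]; trivial; try lra.
    { intros z hz. exact (is_derive_continuous G z _ (hG z hz)). }
    exists z. split; trivial. apply (in_interval_between al be x y); trivial; lra. }
  destruct (functional_choice
    (fun t x => in_interval t0 t1 t -> in_interval al be x /\ G x = t)) as [u hu].
  { intros t. destruct (classic (in_interval t0 t1 t)) as [ht | ht].
    - destruct (hsurj t ht) as [x hx]. exists x. intros _. exact hx.
    - exists 0. intros ht'. contradiction. }
  assert (huG : forall x, in_interval al be x -> u (G x) = x).
  { intros x hx. destruct (hu (G x) (hin x hx)) as [h1 h2].
    destruct (Rtotal_order (u (G x)) x) as [h | [h | h]]; trivial.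
    - specialize (hGi _ _ h1 hx h). lra.
    - specialize (hGi _ _ hx h1 h). lra. }
  assert (hucont : forall t, in_interval t0 t1 t -> continuous u t).
  { intros t ht. destruct (hu t ht) as [hx hGx]. set (x := u t) in *.
    apply continuous_eps. intros eps he.
    destruct (proj1 (locally_Rabs _ _) (in_interval_locally al be x hx))
      as [d [hd hball]].
    set (e := Rmin (d / 2) (eps / 2)).
    assert (he1 : 0 < e) by (apply Rmin_glb_lt; lra).
    assert (he2 : e <= d / 2) by apply Rmin_l.
    assert (he3 : e <= eps / 2) by apply Rmin_r.
    assert (hl : in_interval al be (x - e))
      by (apply hball; rewrite Rabs_left; lra).
    assert (hr : in_interval al be (x + e))
      by (apply hball; rewrite Rabs_right; lra).
    assert (h1 : G (x - e) < t) by (rewrite <- hGx; apply hGi; trivial; lra).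
    assert (h2 : t < G (x + e)) by (rewrite <- hGx; apply hGi; trivial; lra).
    exists (Rmin (t - G (x - e)) (G (x + e) - t)). split.
    { apply Rmin_glb_lt; lra. }
    intros s hs.
    assert (hs1 := Rlt_le_trans _ _ _ hs (Rmin_l _ _)).
    assert (hs2 := Rlt_le_trans _ _ _ hs (Rmin_r _ _)).
    apply Rabs_def2 in hs1. apply Rabs_def2 in hs2.
    assert (hsin : in_interval t0 t1 s).
    { apply (in_interval_between t0 t1 (G (x - e)) (G (x + e))); auto; lra. }
    destruct (hu s hsin) as [hus hGs].
    assert (x - e < u s) by (apply hGi'; trivial; lra).
    assert (u s < x + e) by (apply hGi'; trivial; lra).
    fold x. apply Rabs_def1; lra. }
  exists t0, t1, u, G. split; [| split; [| split]].
  - unfold G. rewrite RInt_point. reflexivity.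
  - intros x hx. auto.
  - intros t ht. destruct (hu t ht) as [hx hGx]. split; [| split]; trivial.
    (* By the mean value theorem for [G], the increment of [u] over [h] is exactly [g z * h] with
       [z] between [u t] and [u (t + h)]; continuity of [u] drives [z] to [u t]. *)
    apply is_derive_Reals. intros eps he.
    destruct (proj1 (continuous_eps g (u t)) (hc _ hx) eps he) as [d1 [hd1 hgd]].
    destruct (proj1 (continuous_eps u t) (hucont t ht) d1 hd1) as [d2 [hd2 hud]].
    destruct (proj1 (locally_Rabs _ _) (in_interval_locally t0 t1 t ht))
      as [d3 [hd3 hball]].
    exists (mkposreal _ (Rmin_glb_lt _ _ _ hd2 hd3)). simpl. intros h hn hh.
    assert (hh2 : Rabs (t + h - t) < d2).
    { replace (t + h - t) with h by ring.
      apply (Rlt_le_trans _ _ _ hh), Rmin_l. }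
    assert (hh3 : Rabs (t + h - t) < d3).
    { replace (t + h - t) with h by ring.
      apply (Rlt_le_trans _ _ _ hh), Rmin_r. }
    specialize (hball _ hh3). specialize (hud _ hh2).
    destruct (hu _ hball) as [hx' hGx'].
    destruct (mean_value al be G (fun x => / g x) (u t) (u (t + h)) hG hx hx')
      as [z [hz heq]].
    assert (hzin : in_interval al be z)
      by (apply (in_interval_minmax al be (u t) (u (t + h))); trivial).
    assert (hgz := hp z hzin).
    rewrite hGx, hGx' in heq.
    assert (hdu : u (t + h) - u t = g z * h).
    { transitivity (g z * (/ g z * (u (t + h) - u t))); [field; lra |].
      rewrite <- heq. ring. }
    rewrite hdu. replace (g z * h / h) with (g z) by (field; trivial).
    apply hgd. apply Rle_lt_trans with (2 := hud). apply Rabs_between, hz.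
  - intros x t hx ht. destruct (hu t ht) as [hux hGu].
    split; intros h; apply hGi'; trivial; lra.
Qed.

(** * Trajectories from radial motions *)

(** Since [p x = 0], the difference quotient of the product is that of [p] times the nearby value of
    [q], so continuity of [q] suffices. This is the product rule used at turning points, where the
    second factor is a speed or a divided difference known only to be continuous. *)
Lemma is_derive_mult_vanishing (p q : R -> R) (x l : R) :
  is_derive p x l -> p x = 0 -> continuous q x ->
  is_derive (fun y => p y * q y) x (l * q x).
Proof.
  intros hp h0 hq. apply is_derive_Reals. intros eps he.
  apply is_derive_Reals in hp.
  (* The two error terms below add up to at most [e * (C - 1)], while [e * C <= eps / 2]. *)
  set (C := Rabs l + Rabs (q x) + 2).
  assert (hC : 0 < C) by (unfold C; pose proof (Rabs_pos l);
    pose proof (Rabs_pos (q x)); lra).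
  set (e := Rmin 1 (eps / (2 * C))).
  assert (he0 : 0 < e).
  { apply Rmin_glb_lt; [lra |]. apply Rdiv_lt_0_compat; lra. }
  assert (he1 : e <= 1) by apply Rmin_l.
  assert (he2 : e * (2 * C) <= eps).
  { apply Rle_trans with (eps / (2 * C) * (2 * C)).
    - apply Rmult_le_compat_r; [lra | apply Rmin_r].
    - right. field. lra. }
  destruct (hp e he0) as [d1 hd1].
  destruct (proj1 (continuous_eps q x) hq e he0) as [d2 [hd2 hq2]].
  exists (mkposreal _ (Rmin_glb_lt _ _ _ (cond_pos d1) hd2)). simpl.
  intros k hk hkd.
  specialize (hd1 k hk (Rlt_le_trans _ _ _ hkd (Rmin_l _ _))).
  assert (hk2 : Rabs (x + k - x) < d2).
  { replace (x + k - x) with k by ring. exact (Rlt_le_trans _ _ _ hkd (Rmin_r _ _)). }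
  specialize (hq2 _ hk2).
  rewrite h0 in hd1 |- *.
  set (w := (p (x + k) - 0) / k) in *.
  replace ((p (x + k) * q (x + k) - 0 * q x) / k - l * q x)
    with ((w - l) * q (x + k) + l * (q (x + k) - q x))
    by (unfold w; field; trivial).
  eapply Rle_lt_trans; [apply Rabs_triang |]. rewrite !Rabs_mult.
  assert (hqk : Rabs (q (x + k)) <= Rabs (q x) + 1).
  { replace (q (x + k)) with (q x + (q (x + k) - q x)) by ring.
    eapply Rle_trans; [apply Rabs_triang |]. lra. }
  assert (Rabs (w - l) * Rabs (q (x + k)) <= e * (Rabs (q x) + 1))
    by (apply Rmult_le_compat; try apply Rabs_pos; lra).
  assert (Rabs l * Rabs (q (x + k) - q x) <= Rabs l * e)
    by (apply Rmult_le_compat_l; try apply Rabs_pos; lra).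
  assert (e * C < eps) by nra.
  unfold C in *. nra.
Qed.

(* Energy conservation determines the acceleration where [rho1] does not vanish;
   at a turning point it must be checked by hand. *)
Lemma energy_acceleration (al be a b : Rbar) (W dW rho rho1 rho2 g : R -> R) (E : R) :
  (forall r, in_interval a b r -> is_derive W r (dW r)) ->
  (forall x, in_interval al be x ->
     in_interval a b (rho x) /\ is_derive rho x (rho1 x) /\
     is_derive rho1 x (rho2 x) /\ continuous g x /\ 0 < g x /\
     (rho1 x * g x) ^ 2 / 2 = E - W (rho x) /\
     (rho1 x = 0 -> rho2 x * g x ^ 2 = - dW (rho x))) ->
  forall x, in_interval al be x ->
    is_derive (fun y => rho1 y * g y) x (- dW (rho x) / g x).
Proof.
  intros hW h x hx.
  destruct (h x hx) as (hin & hr & hr1 & hg & hgp & hen & hturn).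
  destruct (Req_dec (rho1 x) 0) as [h0 | h0].
  - specialize (hturn h0).
    replace (- dW (rho x) / g x) with (rho2 x * g x) by (rewrite <- hturn; field; lra).
    apply is_derive_mult_vanishing; trivial.
  - set (v := fun y => rho1 y * g y).
    assert (hv0 : v x <> 0) by (unfold v; apply Rmult_integral_contrapositive; lra).
    assert (hvc : continuous v x).
    { apply (continuous_mult rho1 g); [| exact hg].
      exact (is_derive_continuous rho1 x _ hr1). }
    assert (hEp : 0 < 2 * (E - W (rho x))).
    { replace (2 * (E - W (rho x))) with (v x ^ 2) by (unfold v; lra).
      apply pow2_gt_0, hv0. }
    (* The energy expresses the absolute value of [v] through [W] and [rho] alone, which makes it
       differentiable although [g] is only continuous. The sign of [v] is constant near [x], so [v]
       itself is differentiable. *)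
    assert (hdS : is_derive (fun y => sqrt (2 * (E - W (rho y)))) x
              (- dW (rho x) * rho1 x / sqrt (2 * (E - W (rho x))))).
    { auto_derive.
      - repeat split; [exists (dW (rho x)); apply hW; trivial | exists (rho1 x); trivial | lra].
      - replace (Derive (fun x0 : R => W x0) (rho x)) with (dW (rho x))
          by (symmetry; apply is_derive_unique, hW, hin).
        replace (Derive (fun x0 : R => rho x0) x) with (rho1 x)
          by (symmetry; apply is_derive_unique, hr).
        replace (2 * (E + - W (rho x))) with (2 * (E - W (rho x))) by ring.
        field. apply Rgt_not_eq, sqrt_lt_R0. lra. }
    assert (hsq : forall y, in_interval al be y ->
              sqrt (2 * (E - W (rho y))) = Rabs (v y)).
    { intros y hy. destruct (h y hy) as (_ & _ & _ & _ & _ & heny & _).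
      rewrite <- heny. rewrite <- sqrt_Rsqr_abs. f_equal. unfold v, Rsqr. field. }
    rewrite (hsq x hx) in hdS.
    destruct (Rlt_or_le 0 (v x)) as [hvp | hvn].
    + rewrite Rabs_right in hdS by lra.
      replace (- dW (rho x) / g x) with (- dW (rho x) * rho1 x / v x)
        by (unfold v; field; lra).
      refine (is_derive_ext_loc _ _ _ _ _ hdS).
      apply filter_imp with (2 := filter_and _ _ (in_interval_locally _ _ _ hx)
                               (continuous_positive_locally _ _ hvc hvp)).
      intros y [hy hyp]. rewrite (hsq y hy), Rabs_right; [reflexivity | lra].
    + rewrite Rabs_left in hdS by lra.
      assert (hvc' : continuous (fun y => - v y) x) by (apply (continuous_opp v), hvc).
      replace (- dW (rho x) / g x) with (- (- dW (rho x) * rho1 x / - v x))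
        by (unfold v; field; lra).
      refine (is_derive_ext_loc _ _ _ _ _ (is_derive_opp _ _ _ hdS)).
      assert (hvp : 0 < - v x) by lra.
      apply filter_imp with (2 := filter_and _ _ (in_interval_locally _ _ _ hx)
                               (continuous_positive_locally _ _ hvc' hvp)).
      intros y [hy hyp]. unfold opp; simpl.
      rewrite (hsq y hy), Rabs_left; [unfold v; ring | lra].
Qed.

Definition radial_motion (a b : Rbar) (dW : R -> R) (t0 t1 : Rbar) (r v : R -> R) : Prop :=
  forall t, in_interval t0 t1 t ->
    in_interval a b (r t) /\ is_derive r t (v t) /\ is_derive v t (- dW (r t)).

(** With respect to the parameter the velocity has derivative [- dW / g]; the chain rule multiplies
    it by [u' = g], and the factor cancels. *)
Lemma radial_motion_of_energy (al be a b : Rbar) (W dW rho rho1 rho2 g : R -> R)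
    (E : R) (t0 t1 : Rbar) (u : R -> R) :
  (forall r, in_interval a b r -> is_derive W r (dW r)) ->
  (forall x, in_interval al be x ->
     in_interval a b (rho x) /\ is_derive rho x (rho1 x) /\
     is_derive rho1 x (rho2 x) /\ continuous g x /\ 0 < g x /\
     (rho1 x * g x) ^ 2 / 2 = E - W (rho x) /\
     (rho1 x = 0 -> rho2 x * g x ^ 2 = - dW (rho x))) ->
  (forall t, in_interval t0 t1 t ->
     in_interval al be (u t) /\ is_derive u t (g (u t))) ->
  radial_motion a b dW t0 t1 (fun t => rho (u t)) (fun t => rho1 (u t) * g (u t)).
Proof.
  intros hW h hu t ht. destruct (hu t ht) as [hx hut].
  pose proof (energy_acceleration al be a b W dW rho rho1 rho2 g E hW h (u t) hx) as hacc.
  destruct (h _ hx) as (hin & hr & _ & _ & hgp & _ & _).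
  split; [exact hin | split].
  - rewrite Rmult_comm. exact (is_derive_comp rho u t _ _ hr hut).
  - replace (- dW (rho (u t))) with (scal (g (u t)) (- dW (rho (u t)) / g (u t))).
    + exact (is_derive_comp (fun y => rho1 y * g y) u t _ _ hacc hut).
    + unfold scal; simpl; unfold mult; simpl. field. lra.
Qed.

(* Conservation of [K = - f^2 phi'] turns the motion into a one-dimensional one
   in the effective potential [V - K^2 / (2 f^2)]. *)
Definition effective_force (f V : R -> R) (K r : R) : R :=
  Derive V r + K ^ 2 * (Derive f r / f r ^ 3).

(** The radial equation reads [r'' = - V' - f f' phi'^2]. Inserting [phi' = - K / f^2] turns the
    last term into [- K^2 f' / f^3], so the right side becomes minus the effective force. *)
Lemma solution_of_radial_motion (a b : Rbar) (f V : R -> R) (K : R)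
    (t0 t1 : Rbar) (r v phi : R -> R) :
  (forall x, in_interval a b x -> f x <> 0) ->
  (forall x, in_interval a b x -> ex_derive f x) ->
  (forall x, in_interval a b x -> ex_derive V x) ->
  Rbar_lt t0 t1 ->
  radial_motion a b (effective_force f V K) t0 t1 r v ->
  (forall t, in_interval t0 t1 t -> is_derive phi t (- K / f (r t) ^ 2)) ->
  is_solution a b f V t0 t1 r phi /\
  forall t, in_interval t0 t1 t -> kinetic_moment f r phi t = K.
Proof.
  intros hf0 hf hV ht01 hr hphi.
  assert (hK : forall t, in_interval t0 t1 t -> kinetic_moment f r phi t = K).
  { intros t ht. unfold kinetic_moment.
    replace (Derive phi t) with (- K / f (r t) ^ 2)
      by (symmetry; apply is_derive_unique, hphi, ht).
    field. apply hf0, (hr t ht). }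
  split; [| exact hK]. split; [exact ht01 |].
  intros t ht. destruct (hr t ht) as (hin & hrt & hvt).
  split; [exact hin | split; [eexists; exact hrt |
    split; [eexists; exact (hphi t ht) |]]].
  unfold euler_lagrange, lagrangian, metric. split.
  - replace (Derive (fun q => / 2 * (Derive r t ^ 2 - f q ^ 2 * Derive phi t ^ 2) - V q) (r t))
      with (- effective_force f V K (r t)).
    + refine (is_derive_ext_loc _ _ _ _ _ hvt).
      apply filter_imp with (2 := in_interval_locally t0 t1 t ht).
      intros s hs. symmetry.
      replace (Derive r s) with (v s)
        by (symmetry; apply is_derive_unique, (hr s hs)).
      apply is_derive_unique. auto_derive; [trivial | field].
    + symmetry. apply is_derive_unique. unfold effective_force. auto_derive.
      * repeat split; [apply hf, hin | apply hV, hin].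
      * replace (Derive (fun x : R => f x) (r t)) with (Derive f (r t)) by reflexivity.
        replace (Derive (fun x : R => V x) (r t)) with (Derive V (r t)) by reflexivity.
        replace (Derive phi t) with (- K / f (r t) ^ 2)
          by (symmetry; apply is_derive_unique, hphi, ht).
        field. apply hf0, hin.
  (* The Lagrangian is independent of the angle, and its derivative in the angular velocity is the
     kinetic moment, which is constantly [K]. *)
  - rewrite Derive_const.
    apply is_derive_ext_loc with (f := fun _ => K); [| apply @is_derive_const].
    apply filter_imp with (2 := in_interval_locally t0 t1 t ht).
    intros s hs. symmetry. rewrite <- (hK s hs). unfold kinetic_moment.
    apply is_derive_unique. auto_derive; [trivial | field].
Qed.

(** The form in which maximality is proved: near both ends of time [r] avoids any prescribed compact
    part of [(a, b)], so it has no limit inside through which the curve could be continued. *)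
Definition leaves_compacts (a b t0 t1 : Rbar) (r : R -> R) : Prop :=
  forall x y, in_interval a b x -> in_interval a b y ->
    exists s0 s1, in_interval t0 t1 s0 /\ in_interval t0 t1 s1 /\
      forall t, in_interval t0 t1 t -> t < s0 \/ s1 < t -> ~ (x < r t < y).

Lemma solution_continuous_inside (a b : Rbar) (f V : R -> R) (s0 s1 : Rbar)
    (r phi : R -> R) (t : R) :
  is_solution a b f V s0 s1 r phi -> in_interval s0 s1 t ->
  exists x y, in_interval a b x /\ in_interval a b y /\
    locally t (fun s => x < r s < y).
Proof.
  intros [_ h] ht. destruct (h t ht) as (hin & hr & _).
  destruct (in_interval_below a b _ hin) as [x [hx hxr]].
  destruct (in_interval_above a b _ hin) as [y [hy hyr]].
  exists x, y. split; [exact hx | split; [exact hy |]].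
  apply (ex_derive_continuous r t hr (fun z => x < z < y)).
  apply (locally_interval _ (r t) x y); simpl; auto.
Qed.

(** An extension beyond an end point would be continuous there, hence confined between two points of
    [(a, b)] close to that time; but [r], with which it agrees on one side, is outside. *)
Lemma trajectory_of_leaving (a b : Rbar) (f V : R -> R) (t0 t1 : Rbar) (r phi : R -> R) :
  is_solution a b f V t0 t1 r phi -> leaves_compacts a b t0 t1 r ->
  is_trajectory a b f V t0 t1 r phi.
Proof.
  intros hsol hleave. split; [exact hsol |].
  intros s0 s1 r' phi' hsol' h0 h1 hag.
  destruct (in_interval_nonempty t0 t1 (proj1 hsol)) as [c [hc0 hc1]].
  split.
  - destruct (Rbar_le_lt_or_eq_dec _ _ h0) as [hlt |]; [exfalso | trivial].
    (* An end point that the extension passes strictly is finite. *)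
    assert (exists t : R, t0 = t) as [t ->].
    { destruct t0 as [t| |]; [exists t; trivial | contradiction |].
      destruct s0; contradiction. }
    assert (ht : in_interval s0 s1 t).
    { split; trivial. apply Rbar_lt_le_trans with t1; trivial.
      apply Rbar_lt_trans with c; trivial. }
    destruct (solution_continuous_inside _ _ _ _ _ _ _ _ t hsol' ht)
      as (x & y & hx & hy & hl).
    apply locally_Rabs in hl. destruct hl as [d [hd hl]].
    destruct (hleave x y hx hy) as (p & q & hp & hq & hpq).
    simpl in hc0. destruct hp as [hp hp1]. simpl in hp.
    set (s := Rmin ((t + p) / 2) (t + d / 2)).
    assert (s <= (t + p) / 2) by apply Rmin_l.
    assert (s <= t + d / 2) by apply Rmin_r.
    assert (t < s) by (apply Rmin_glb_lt; lra).
    assert (hs : in_interval t t1 s).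
    { split; [simpl; trivial |]. apply Rbar_le_lt_trans with p; trivial. simpl. lra. }
    apply (hpq s hs); [left; lra |].
    rewrite <- (proj1 (hag s hs)). apply hl. rewrite Rabs_right; lra.
  - destruct (Rbar_le_lt_or_eq_dec _ _ h1) as [hlt |]; [exfalso | auto].
    assert (exists t : R, t1 = t) as [t ->].
    { destruct t1 as [t| |]; [exists t; trivial | | contradiction].
      destruct s1; contradiction. }
    assert (ht : in_interval s0 s1 t).
    { split; trivial. apply Rbar_le_lt_trans with t0; trivial.
      apply Rbar_lt_trans with c; trivial. }
    destruct (solution_continuous_inside _ _ _ _ _ _ _ _ t hsol' ht)
      as (x & y & hx & hy & hl).
    apply locally_Rabs in hl. destruct hl as [d [hd hl]].
    destruct (hleave x y hx hy) as (p & q & hp & hq & hpq).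
    simpl in hc1. destruct hq as [hq0 hq]. simpl in hq.
    set (s := Rmax ((t + q) / 2) (t - d / 2)).
    assert ((t + q) / 2 <= s) by apply Rmax_l.
    assert (t - d / 2 <= s) by apply Rmax_r.
    assert (s < t) by (apply Rmax_lub_lt; lra).
    assert (hs : in_interval t0 t s).
    { split; [| simpl; trivial]. apply Rbar_lt_le_trans with q; trivial. simpl. lra. }
    apply (hpq s hs); [right; lra |].
    rewrite <- (proj1 (hag s hs)). apply hl. rewrite Rabs_left; lra.
Qed.

Lemma trajectory_of_global_solution (a b : Rbar) (f V : R -> R) (r phi : R -> R) :
  is_solution a b f V m_infty p_infty r phi ->
  is_trajectory a b f V m_infty p_infty r phi.
Proof.
  intros hsol. split; [exact hsol |].
  intros s0 s1 r' phi' _ h0 h1 _.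
  destruct s0, s1; simpl in *; try contradiction; auto.
Qed.

(** One radius [r s] that is never met again excludes every period [T], since periodicity would give
    [r (s + T) = r s]. The condition on compacts is there to make the lifted solution maximal. *)
Definition escaping (a b : Rbar) (dW : R -> R) : Prop :=
  exists (t0 t1 : Rbar) (r v : R -> R) (s : R),
    in_interval t0 t1 s /\ radial_motion a b dW t0 t1 r v /\
    leaves_compacts a b t0 t1 r /\
    forall t, in_interval t0 t1 t -> s < t -> r t <> r s.

(** The angle is recovered from the radial motion by integrating [- K / f^2]. The resulting maximal
    trajectory has moment [K <> 0], so it is nonsingular and would have to be periodic. *)
Lemma not_escaping (a b : Rbar) (f V : R -> R) (K : R) :
  (forall x, in_interval a b x -> f x <> 0) ->
  (forall x, in_interval a b x -> ex_derive f x) ->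
  (forall x, in_interval a b x -> ex_derive V x) ->
  K <> 0 -> completely_closing a b f V -> ~ escaping a b (effective_force f V K).
Proof.
  intros hf0 hf hV hK hcc (t0 & t1 & r & v & s & hs & hr & hleave & hnr).
  assert (hlt : Rbar_lt t0 t1) by (apply Rbar_lt_trans with s; apply hs).
  set (phi := RInt (fun t => - K / f (r t) ^ 2) s).
  assert (hphi : forall t, in_interval t0 t1 t -> is_derive phi t (- K / f (r t) ^ 2)).
  { apply (antiderivative_interval t0 t1 (fun t => - K / f (r t) ^ 2) s hs).
    intros t ht. destruct (hr t ht) as (hin & hrt & _).
    apply (ex_derive_continuous (fun t => - K / f (r t) ^ 2)). auto_derive.
    repeat split; [apply hf, hin | eexists; exact hrt |].
    specialize (hf0 _ hin).
    apply Rmult_integral_contrapositive; split; trivial.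
    apply Rmult_integral_contrapositive; split; [trivial | lra]. }
  destruct (solution_of_radial_motion a b f V K t0 t1 r v phi hf0 hf hV hlt hr hphi)
    as [hsol hmom].
  destruct (hcc t0 t1 r phi (trajectory_of_leaving _ _ _ _ _ _ _ _ hsol hleave))
    as (-> & -> & T & hT & hper).
  - intros hsing. apply hK. rewrite <- (hmom s hs). apply hsing, hs.
  - apply (hnr (s + T)); [split; exact I | lra |]. symmetry. apply (hper s).
Qed.

(** Reflection [r -> - r] of the interval; [- dW (- r)] is the derivative of the reflected potential
    [W (- r)]. It transfers results for the left side to the right side. *)
Lemma escaping_opp (a b : Rbar) (dW : R -> R) :
  escaping (Rbar_opp b) (Rbar_opp a) (fun r => - dW (- r)) -> escaping a b dW.
Proof.
  intros (t0 & t1 & r & v & s & hs & hr & hleave & hnr).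
  exists t0, t1, (fun t => - r t), (fun t => - v t), s.
  split; [exact hs | split; [| split]].
  - intros t ht. destruct (hr t ht) as (hin & hrt & hvt).
    split; [| split].
    + apply in_interval_opp. rewrite Ropp_involutive. exact hin.
    + exact (is_derive_opp r t _ hrt).
    + replace (- dW (- r t)) with (opp (- - dW (- r t)))
        by (unfold opp; simpl; ring).
      exact (is_derive_opp v t _ hvt).
  - intros x y hx hy.
    destruct (hleave (- y) (- x)) as (s0 & s1 & h0 & h1 & h);
      try (apply in_interval_opp; trivial).
    exists s0, s1. split; [exact h0 | split; [exact h1 |]].
    intros t ht hts hxy. apply (h t ht hts). lra.
  - intros t ht hst heq. apply (hnr t ht hst). lra.
Qed.

(** * Level crossings and regular values *)

Lemma first_crossing (a b : Rbar) (g : R -> R) (c y e : R) :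
  (forall x, in_interval a b x -> continuous g x) ->
  in_interval a b c -> in_interval a b y -> c <= y -> g c < e < g y ->
  exists z, c < z < y /\ g z = e /\ forall x, c <= x < z -> g x < e.
Proof.
  intros hg hc hy hcy [hgc hgy].
  (* The crossing is the supremum of the points up to which [g] stays below [e]. By continuity a
     value below [e] there would allow going further, and a value above [e] would already be
     exceeded earlier. *)
  set (P := fun x => c <= x <= y /\ forall t, c <= t <= x -> g t < e).
  assert (hPc : P c).
  { split; [lra |]. intros t ht. replace t with c by lra. exact hgc. }
  destruct (completeness P) as [m [hub hlub]].
  { exists y. intros x [hx _]. lra. }
  { exists c. exact hPc. }
  assert (hcm : c <= m) by (apply hub, hPc).
  assert (hmy : m <= y) by (apply hlub; intros x [hx _]; lra).
  assert (hm : in_interval a b m) by (apply (in_interval_between a b c y); auto).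
  assert (hbelow : forall x, c <= x < m -> g x < e).
  { intros x hx. apply NNPP. intros hn. assert (m <= x); [| lra].
    apply hlub. intros z [hz hzt]. apply Rnot_lt_le. intros hxz.
    apply hn, hzt. lra. }
  assert (hgm : g m = e).
  { destruct (Rtotal_order (g m) e) as [h | [h | h]]; trivial; exfalso.
    - destruct (proj1 (continuous_eps g m) (hg m hm) (e - g m)) as [d [hd hnear]]; [lra |].
      assert (hmy' : m <> y) by (intros ->; lra).
      set (z := Rmin y (m + d / 2)).
      assert (z <= y) by apply Rmin_l. assert (z <= m + d / 2) by apply Rmin_r.
      assert (m < z) by (apply Rmin_glb_lt; lra).
      assert (P z); [| assert (z <= m) by (apply hub; trivial); lra].
      split; [lra |]. intros t ht. destruct (Rlt_or_le t m) as [htm | htm].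
      + apply hbelow. lra.
      + assert (ht' : Rabs (t - m) < d) by (rewrite Rabs_right; lra).
        specialize (hnear t ht'). apply Rabs_def2 in hnear. lra.
    - destruct (proj1 (continuous_eps g m) (hg m hm) (g m - e)) as [d [hd hnear]]; [lra |].
      assert (hcm' : m <> c) by (intros ->; lra).
      set (z := Rmax c (m - d / 2)).
      assert (c <= z) by apply Rmax_l. assert (m - d / 2 <= z) by apply Rmax_r.
      assert (z < m) by (apply Rmax_lub_lt; lra).
      assert (hz : Rabs (z - m) < d) by (rewrite Rabs_left; lra).
      specialize (hnear z hz). apply Rabs_def2 in hnear.
      specialize (hbelow z). lra. }
  exists m. split; [| split; trivial].
  destruct (Req_dec m c) as [-> |]; [lra |]. destruct (Req_dec m y) as [-> |]; lra.
Qed.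

Lemma last_crossing (a b : Rbar) (g : R -> R) (c y e : R) :
  (forall x, in_interval a b x -> continuous g x) ->
  in_interval a b c -> in_interval a b y -> y <= c -> g c < e < g y ->
  exists z, y < z < c /\ g z = e /\ forall x, z < x <= c -> g x < e.
Proof.
  intros hg hc hy hcy he.
  destruct (first_crossing (Rbar_opp b) (Rbar_opp a) (fun x => g (- x)) (- c) (- y) e)
    as [z [hz [hgz hlt]]]; try (apply in_interval_opp; trivial).
  - intros x hx. apply (continuous_comp (fun y => - y) g).
    + apply (ex_derive_continuous (fun y => - y)). auto_derive. trivial.
    + apply hg, in_interval_opp. rewrite Ropp_involutive. exact hx.
  - lra.
  - rewrite !Ropp_involutive. exact he.
  - exists (- z). split; [lra | split; [exact hgz |]].
    intros x hx. rewrite <- (Ropp_involutive x). apply hlt. lra.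
Qed.

Lemma pigeonhole (n : nat) (h : nat -> nat) :
  (forall j, (j <= n)%nat -> (h j < n)%nat) ->
  exists i j, (i < j <= n)%nat /\ h i = h j.
Proof.
  intros hh. apply NNPP. intros hn.
  assert (hnd : NoDup (map h (seq 0 (S n)))).
  { apply NoDup_map_NoDup_ForallPairs; [| apply seq_NoDup].
    intros i j hi hj hij. apply in_seq in hi, hj.
    destruct (Nat.lt_trichotomy i j) as [h1 | [h1 | h1]]; trivial;
      exfalso; apply hn.
    - exists i, j. split; [lia | trivial].
    - exists j, i. split; [lia | auto]. }
  assert (hincl : incl (map h (seq 0 (S n))) (seq 0 n)).
  { intros k hk. apply in_map_iff in hk. destruct hk as [i [<- hi]].
    apply in_seq in hi. apply in_seq. specialize (hh i). lia. }
  pose proof (NoDup_incl_length hnd hincl) as hlen.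
  rewrite length_map, !length_seq in hlen. lia.
Qed.

(* One-dimensional Sard theorem: on a piece of length [w] containing a critical
   point the function varies by [o(w)], so the critical values are covered by
   intervals of arbitrarily small total length. *)
Lemma regular_value (a b : Rbar) (g dg : R -> R) (x y e1 e2 : R) :
  (forall z, in_interval a b z -> is_derive g z (dg z)) ->
  (forall z, in_interval a b z -> continuous dg z) ->
  in_interval a b x -> in_interval a b y -> x < y -> e1 < e2 ->
  exists e, e1 < e < e2 /\ forall z, x <= z <= y -> g z = e -> dg z <> 0.
Proof.
  intros hg hdg hx hy hxy he. apply NNPP. intros hn.
  (* If no level is regular, each level [e] in the range is attained at a critical point [zc e]. *)
  assert (hcrit : forall e, exists z, e1 < e < e2 -> x <= z <= y /\ g z = e /\ dg z = 0).
  { intros e. destruct (classic (e1 < e < e2)) as [he' | he'].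
    - apply NNPP. intros hz. apply hn. exists e. split; [exact he' |].
      intros z hzin hge h0. apply hz. exists z. auto.
    - exists 0. intros; contradiction. }
  destruct (functional_choice _ hcrit) as [zc hzc].
  set (L := y - x). set (D := e2 - e1).
  (* Within one of [N] pieces the values at two points, one of them critical, will differ by less
     than [eps * (L / N) = D / (4 * N)]. This does not exceed the spacing [D / (N + 3)] of the
     chosen levels, because [N >= 1]. *)
  set (eps := D / (4 * L)).
  assert (hL : 0 < L) by (unfold L; lra).
  assert (hD : 0 < D) by (unfold D; lra).
  assert (heps : 0 < eps) by (apply Rdiv_lt_0_compat; lra).
  destruct (unifcont_normed_1d dg x y) with (eps := mkposreal eps heps) as [d hd].
  { intros z hz. apply hdg, (in_interval_between a b x y); trivial. }
  simpl in hd.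
  assert (hN : exists N, (1 <= N)%nat /\ L / d < INR N).
  { destruct (nfloor_ex (L / d)) as [N [_ hN]].
    { apply Rlt_le, Rdiv_lt_0_compat; [exact hL | apply cond_pos]. }
    exists (S N). split; [lia |]. rewrite S_INR. exact hN. }
  destruct hN as [N [hN1 hN]].
  assert (hNp : 1 <= INR N) by (apply (le_INR 1), hN1).
  assert (hwd : L / INR N < d).
  { assert (hdp := cond_pos d). apply Rmult_lt_reg_r with (INR N / d).
    - apply Rdiv_lt_0_compat; lra.
    - replace (L / INR N * (INR N / d)) with (L / d) by (field; lra).
      replace (d * (INR N / d)) with (INR N) by (field; lra). exact hN. }
  set (e := fun j => e1 + D * (INR (S j) / INR (N + 3))).
  assert (hN3 : INR (N + 3) = INR N + 3) by (rewrite plus_INR; simpl; ring).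
  assert (hein : forall j, (j <= S N)%nat -> e1 < e j < e2).
  { intros j hj. unfold e. rewrite hN3.
    assert (hj1 := le_INR _ _ hj). rewrite S_INR in hj1.
    assert (hj0 := pos_INR j). rewrite S_INR.
    assert (0 < (INR j + 1) / (INR N + 3)) by (apply Rdiv_lt_0_compat; lra).
    assert ((INR j + 1) / (INR N + 3) < 1).
    { apply Rmult_lt_reg_r with (INR N + 3); [lra |].
      replace ((INR j + 1) / (INR N + 3) * (INR N + 3)) with (INR j + 1) by (field; lra).
      lra. }
    split; [assert (0 < D * ((INR j + 1) / (INR N + 3))) by (apply Rmult_lt_0_compat; lra); lra |].
    assert (D * ((INR j + 1) / (INR N + 3)) < D * 1) by (apply Rmult_lt_compat_l; lra).
    unfold D in *. lra. }
  (* The index of the piece of length [L / N] that contains [z]. The end point [y] gets index [N],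
     so [N + 1] indices occur; this is why [N + 2] levels are taken. *)
  assert (hidx : forall z, exists k : nat, x <= z <= y ->
            INR k <= (z - x) / L * INR N < INR k + 1).
  { intros z. destruct (classic (x <= z <= y)) as [hz | hz].
    - destruct (nfloor_ex ((z - x) / L * INR N)) as [k hk].
      + apply Rmult_le_pos; [| lra]. apply Rdiv_le_0_compat; lra.
      + exists k. auto.
    - exists 0%nat. intros; contradiction. }
  destruct (functional_choice _ hidx) as [idx hidx'].
  destruct (pigeonhole (S N) (fun j => idx (zc (e j)))) as (i & j & hij & heq).
  { intros j hj. destruct (hzc _ (hein j hj)) as (hz & _ & _).
    specialize (hidx' _ hz). apply INR_lt. rewrite S_INR.
    assert ((zc (e j) - x) / L <= 1).
    { apply Rmult_le_reg_r with L; [exact hL |].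
      replace ((zc (e j) - x) / L * L) with (zc (e j) - x) by (field; lra).
      unfold L. lra. }
    nra. }
  destruct (hzc _ (hein i ltac:(lia))) as (hzi & hgi & hdi).
  destruct (hzc _ (hein j ltac:(lia))) as (hzj & hgj & _).
  pose proof (hidx' _ hzi) as hki. pose proof (hidx' _ hzj) as hkj.
  rewrite heq in hki. set (zi := zc (e i)) in *. set (zj := zc (e j)) in *.
  assert (hclose : Rabs (zj - zi) <= L / INR N).
  { replace (zj - zi) with (((zj - x) / L * INR N - (zi - x) / L * INR N) * (L / INR N))
      by (field; lra).
    assert (0 < L / INR N) by (apply Rdiv_lt_0_compat; lra).
    rewrite Rabs_mult, (Rabs_right (L / INR N)) by lra.
    rewrite <- (Rmult_1_l (L / INR N)) at 2.
    apply Rmult_le_compat_r; [lra |]. apply Rabs_le. lra. }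
  assert (hii : in_interval a b zi) by (apply (in_interval_between a b x y); trivial).
  assert (hij' : in_interval a b zj) by (apply (in_interval_between a b x y); trivial).
  destruct (mean_value a b g dg zi zj hg hii hij') as [z [hz hmv]].
  assert (hzxy : x <= z <= y).
  { unfold Rmin, Rmax in hz. destruct (Rle_dec zi zj); lra. }
  assert (hdz : Rabs (dg z) < eps).
  { assert (hb : ball zi d z).
    { apply Rle_lt_trans with (Rabs (zj - zi)); [apply Rabs_between, hz | lra]. }
    specialize (hd zi z hzi hzxy hb). unfold ball_norm in hd.
    unfold norm in hd; simpl in hd. unfold abs, minus, plus, opp in hd; simpl in hd.
    rewrite hdi in hd. replace (dg z + - 0) with (dg z) in hd by ring. exact hd. }
  assert (hgap : D / (INR N + 3) <= Rabs (g zj - g zi)).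
  { rewrite hgi, hgj. unfold e. rewrite hN3, !S_INR.
    assert (hij1 : INR i + 1 <= INR j) by (rewrite <- S_INR; apply le_INR; lia).
    replace (e1 + D * ((INR j + 1) / (INR N + 3)) - (e1 + D * ((INR i + 1) / (INR N + 3))))
      with (D / (INR N + 3) * (INR j - INR i)) by (field; lra).
    assert (0 < D / (INR N + 3)) by (apply Rdiv_lt_0_compat; lra).
    rewrite Rabs_right by nra. nra. }
  rewrite hmv, Rabs_mult in hgap.
  destruct (Req_dec (Rabs (dg z)) 0) as [h0 | h0].
  { rewrite h0, Rmult_0_l in hgap.
    assert (0 < D / (INR N + 3)) by (apply Rdiv_lt_0_compat; lra). lra. }
  assert (hlt : Rabs (dg z) * Rabs (zj - zi) < eps * (L / INR N)).
  { assert (0 < L / INR N) by (apply Rdiv_lt_0_compat; lra).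
    assert (0 < Rabs (dg z)) by (pose proof (Rabs_pos (dg z)); lra).
    apply Rle_lt_trans with (Rabs (dg z) * (L / INR N)).
    - apply Rmult_le_compat_l; lra.
    - apply Rmult_lt_compat_r; lra. }
  replace (eps * (L / INR N)) with (D / (4 * INR N)) in hlt
    by (unfold eps; field; lra).
  assert (D / (4 * INR N) <= D / (INR N + 3)); [| lra].
  apply Rmult_le_compat_l; [lra |]. apply Rinv_le_contravar; lra.
Qed.

Lemma nonneg_derive_of_left_max (g : R -> R) (x l : R) :
  is_derive g x l -> (exists d, 0 < d /\ forall y, x - d < y < x -> g y <= g x) -> 0 <= l.
Proof.
  intros hg [d [hd hmax]]. apply Rnot_lt_le. intros hl.
  apply is_derive_Reals in hg. destruct (hg (- l) ltac:(lra)) as [e he].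
  assert (hep := cond_pos e). set (h := Rmin (d / 2) (e / 2)).
  assert (h <= d / 2) by apply Rmin_l. assert (h <= e / 2) by apply Rmin_r.
  assert (0 < h) by (apply Rmin_glb_lt; lra).
  assert (hh : Rabs (- h) < e) by (rewrite Rabs_left; lra).
  specialize (he (- h) ltac:(lra) hh). apply Rabs_def2 in he.
  specialize (hmax (x + - h) ltac:(lra)).
  set (q := (g (x + - h) - g x) / - h) in *.
  assert (q * - h = g (x + - h) - g x) by (unfold q; field; lra).
  nra.
Qed.

Lemma nonpos_derive_of_right_max (g : R -> R) (x l : R) :
  is_derive g x l -> (exists d, 0 < d /\ forall y, x < y < x + d -> g y <= g x) -> l <= 0.
Proof.
  intros hg [d [hd hmax]].
  assert (0 <= - l); [| lra].
  apply (nonneg_derive_of_left_max (fun y => g (- y)) (- x)).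
  - replace (- l) with (scal (- 1) l) by (unfold scal; simpl; unfold mult; simpl; ring).
    apply (is_derive_comp g (fun y => - y)).
    + rewrite Ropp_involutive. exact hg.
    + auto_derive; [trivial | ring].
  - exists d. split; [exact hd |]. intros y hy. rewrite Ropp_involutive.
    apply hmax. lra.
Qed.

(** At a regular level [E] just above the bottom value [V c], the well is the component of [V < E]
    around [c], found by the crossings nearest to [c]. One-sided maximality gives the weak signs of
    the slopes at its ends, and regularity of [E] makes them strict. *)
Lemma regular_well (a b : Rbar) (V dV : R -> R) (x c y : R) :
  (forall r, in_interval a b r -> is_derive V r (dV r)) ->
  (forall r, in_interval a b r -> continuous dV r) ->
  in_interval a b x -> in_interval a b y -> x < c < y -> V c < V x -> V c < V y ->
  exists r1 s, in_interval a b r1 /\ in_interval a b s /\ r1 < s /\ V s = V r1 /\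
    (forall r, r1 < r < s -> V r < V r1) /\ dV r1 < 0 /\ 0 < dV s.
Proof.
  intros hV hdV hx hy hc hcx hcy.
  destruct (regular_value a b V dV x y (V c) (Rmin (V x) (V y)) hV hdV hx hy)
    as (E & [hE1 hE2] & hreg); [lra | apply Rmin_glb_lt; trivial |].
  assert (hEx := Rlt_le_trans _ _ _ hE2 (Rmin_l _ _)).
  assert (hEy := Rlt_le_trans _ _ _ hE2 (Rmin_r _ _)).
  assert (hVc : forall r, in_interval a b r -> continuous V r).
  { intros r hr. exact (is_derive_continuous V r _ (hV r hr)). }
  assert (hci : in_interval a b c) by (apply (in_interval_between a b x y); trivial; lra).
  destruct (first_crossing a b V c y E) as (s & hs & hVs & hlts); trivial; try lra.
  destruct (last_crossing a b V c x E) as (r1 & hr1 & hVr1 & hltr1); trivial; try lra.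
  assert (hsi : in_interval a b s) by (apply (in_interval_between a b x y); trivial; lra).
  assert (hr1i : in_interval a b r1) by (apply (in_interval_between a b x y); trivial; lra).
  exists r1, s. split; [exact hr1i | split; [exact hsi | split; [lra | split; [lra |]]]].
  assert (hwell : forall r, r1 < r < s -> V r < V r1).
  { intros r hr. rewrite hVr1. destruct (Rle_or_lt r c).
    - apply hltr1. lra.
    - apply hlts. lra. }
  split; [exact hwell | split].
  - assert (dV r1 <> 0) by (apply hreg; lra).
    assert (dV r1 <= 0); [| lra].
    apply (nonpos_derive_of_right_max V r1); [apply hV, hr1i |].
    exists (s - r1). split; [lra |]. intros r hr. left. apply hwell. lra.
  - assert (dV s <> 0) by (apply hreg; lra).
    assert (0 <= dV s); [| lra].
    apply (nonneg_derive_of_left_max V s); [apply hV, hsi |].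
    exists (s - r1). split; [lra |]. intros r hr. left. rewrite hVs, <- hVr1.
    apply hwell. lra.
Qed.

(** * Divided differences *)

(* The divided difference [F[r, s]]. *)
Definition dd (F : R -> R) (r s : R) : R :=
  if Req_EM_T r s then Derive F s else (F r - F s) / (r - s).

Lemma dd_mult (F : R -> R) (r s : R) : F r - F s = (r - s) * dd F r s.
Proof.
  unfold dd. destruct (Req_EM_T r s) as [-> | h]; [ring |]. field. lra.
Qed.

Lemma dd_diag (F : R -> R) (s : R) : dd F s s = Derive F s.
Proof. unfold dd. destruct (Req_EM_T s s); congruence. Qed.

Lemma dd_neq (F : R -> R) (r s : R) : r <> s -> dd F r s = (F r - F s) / (r - s).
Proof. intros h. unfold dd. destruct (Req_EM_T r s); congruence. Qed.

Lemma locally_neq (r s : R) : r <> s -> locally r (fun x => x <> s).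
Proof.
  intros h. apply locally_Rabs. exists (Rabs (r - s)). split.
  - apply Rabs_pos_lt. lra.
  - intros y hy ->. rewrite Rabs_minus_sym in hy. lra.
Qed.

Lemma dd_continuous_l (F : R -> R) (r s : R) :
  ex_derive F r -> continuous (fun x => dd F x s) r.
Proof.
  intros hF. destruct (Req_dec r s) as [<- | h].
  - apply continuous_eps. intros eps he. rewrite dd_diag.
    assert (hl := Derive_correct F r hF). apply is_derive_Reals in hl.
    destruct (hl eps he) as [d hd]. exists d. split; [apply cond_pos |].
    intros y hy. unfold dd. destruct (Req_EM_T y r) as [-> | hn].
    + rewrite Rminus_diag, Rabs_R0. exact he.
    + specialize (hd (y - r)). replace (r + (y - r)) with y in hd by ring.
      apply hd; [lra | exact hy].
  - apply (continuous_ext_loc _ (fun x => (F x - F s) / (x - s))).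
    + apply filter_imp with (2 := locally_neq r s h).
      intros x hx. symmetry. apply dd_neq, hx.
    + apply (ex_derive_continuous (fun x => (F x - F s) / (x - s))).
      auto_derive. repeat split; trivial. lra.
Qed.

(** Off the diagonal this is continuity of a quotient. Near a diagonal point the mean value theorem
    makes every divided difference a value of [dF] at a nearby point. *)
Lemma dd_continuous (F dF : R -> R) (r s : R) :
  continuous F r -> continuous F s ->
  (r = s -> locally s (fun x => is_derive F x (dF x)) /\ continuous dF s) ->
  continuous (fun z : R * R => dd F (fst z) (snd z)) (r, s).
Proof.
  intros hr hs hd. destruct (Req_dec r s) as [<- | hn].
  - destruct (hd eq_refl) as [hl hc]. clear hd.
    intros P [eps hP]. simpl in hP.
    destruct (proj1 (continuous_eps dF r) hc eps (cond_pos eps)) as [d1 [hd1 hc1]].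
    apply locally_Rabs in hl. destruct hl as [d2 [hd2 hl]].
    set (d := Rmin d1 d2).
    assert (d <= d1) by apply Rmin_l. assert (d <= d2) by apply Rmin_r.
    assert (hd0 : 0 < d) by (apply Rmin_glb_lt; trivial).
    exists (mkposreal d hd0). intros [x y] [hx hy]. apply hP. simpl.
    change (Rabs (x - r) < d) in hx. change (Rabs (y - r) < d) in hy.
    change (Rabs (dd F x y - dd F r r) < eps).
    rewrite dd_diag, (is_derive_unique F r (dF r))
      by (apply hl; rewrite Rminus_diag, Rabs_R0; exact hd2).
    assert (hI : forall z, in_interval (Finite (r - d)) (Finite (r + d)) z <-> Rabs (z - r) < d).
    { intros z. unfold in_interval; simpl. split.
      - intros [h1 h2]. apply Rabs_def1; lra.
      - intros h. apply Rabs_def2 in h. lra. }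
    assert (hz : exists z, Rabs (z - r) < d /\ dd F x y = dF z).
    { destruct (Req_dec x y) as [-> | hxy].
      - exists y. split; [exact hy |]. rewrite dd_diag. apply is_derive_unique, hl. lra.
      - destruct (mean_value (Finite (r - d)) (Finite (r + d)) F dF y x) as [z [hz heq]].
        + intros z hz. apply hI in hz. apply hl. lra.
        + apply hI, hy.
        + apply hI, hx.
        + exists z. split.
          * apply hI. apply (in_interval_minmax _ _ y x); trivial; apply hI; trivial.
          * rewrite dd_neq by trivial. rewrite heq. field. lra. }
    destruct hz as [z [hz ->]]. apply hc1. lra.
  - assert (hsub : continuous (fun z : R * R => fst z - snd z) (r, s)).
    { apply (continuous_minus (fun z : R * R => fst z) (fun z : R * R => snd z)).
      - apply continuous_fst.
      - apply continuous_snd. }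
    apply (continuous_ext_loc _ (fun z : R * R => (F (fst z) - F (snd z)) * / (fst z - snd z))).
    + assert (hl : locally (r - s) (fun w => w <> 0)) by (apply locally_neq; lra).
      refine (filter_imp (fun z : R * R => fst z - snd z <> 0) _ _ (hsub (fun w => w <> 0) hl)).
      intros z hz. rewrite dd_neq; [reflexivity | lra].
    + apply (continuous_mult (fun z : R * R => F (fst z) - F (snd z))
               (fun z : R * R => / (fst z - snd z))).
      * apply (continuous_minus (fun z : R * R => F (fst z)) (fun z : R * R => F (snd z))).
        -- apply (continuous_comp fst F); [apply continuous_fst | exact hr].
        -- apply (continuous_comp snd F); [apply continuous_snd | exact hs].
      * apply (continuous_comp (fun z : R * R => fst z - snd z) Rinv); [exact hsub |].
        apply continuous_Rinv. simpl. lra.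
Qed.

(** Second divided differences of a [C^1] function, as long as [s] avoids [r1]. If [r = s], the
    first difference is [C^1] around this point by the quotient rule; if [r <> s], in particular if
    [r = r1], its continuity is enough. *)
Lemma dd_dd_continuous (a b : Rbar) (F dF : R -> R) (r1 r s : R) :
  (forall x, in_interval a b x -> is_derive F x (dF x)) ->
  (forall x, in_interval a b x -> continuous dF x) ->
  in_interval a b r -> in_interval a b s -> s <> r1 ->
  continuous (fun z : R * R => dd (fun x => dd F x r1) (fst z) (snd z)) (r, s).
Proof.
  intros hF hdF hr hs hn.
  apply (dd_continuous _ (fun x => (dF x * (x - r1) - (F x - F r1)) / (x - r1) ^ 2)).
  - apply dd_continuous_l. eexists. apply hF, hr.
  - apply dd_continuous_l. eexists. apply hF, hs.
  - intros _. split.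
    + apply filter_imp with (2 := filter_and _ _ (in_interval_locally a b s hs)
                                    (locally_open _ _ (open_neq r1) (fun _ h => h) s hn)).
      intros x [hx hxn].
      apply (is_derive_ext_loc (fun y => (F y - F r1) / (y - r1))).
      * apply filter_imp with (2 := locally_neq x r1 hxn).
        intros y hy. symmetry. apply dd_neq, hy.
      * auto_derive.
        -- repeat split; [eexists; apply hF, hx | lra].
        -- replace (Derive (fun x0 : R => F x0) x) with (dF x)
             by (symmetry; apply is_derive_unique, hF, hx).
           field. lra.
    + apply (continuous_mult (fun x => dF x * (x - r1) - (F x - F r1))
               (fun x => / (x - r1) ^ 2)).
      * apply (continuous_minus (fun x => dF x * (x - r1)) (fun x => F x - F r1)).
        -- apply (continuous_mult dF (fun x => x - r1)); [apply hdF, hs |].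
           apply (ex_derive_continuous (fun x => x - r1)). auto_derive. trivial.
        -- apply (ex_derive_continuous (fun x => F x - F r1)). auto_derive.
           eexists. apply hF, hs.
      * apply (ex_derive_continuous (fun x => / (x - r1) ^ 2)). auto_derive.
        repeat (apply Rmult_integral_contrapositive; split); lra.
Qed.

(** * Escaping orbits *)

(** The orbit of energy [W r2] comes from the end [a], touches [r2] once and returns to [a]. The
    fold [r2 - u ^ 2] describes both branches with a single increasing parameter, and the time of
    reflection is the one whose radius is not met again. *)
Lemma reflecting_escape (a b : Rbar) (W dW : R -> R) (r2 : R) :
  (forall r, in_interval a b r -> is_derive W r (dW r)) ->
  in_interval a b r2 ->
  (forall r, in_interval a b r -> r < r2 -> W r < W r2) -> 0 < dW r2 ->
  escaping a b dW.
Proof.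
  intros hW hr2 hlt hd2.
  (* [rho u] stays above [a] exactly for [u ^ 2 < r2 - a]; for [a = m_infty] the parameter is
     unrestricted. *)
  set (be := match a with Finite a' => Finite (sqrt (r2 - a')) | _ => p_infty end).
  set (rho := fun u => r2 - u ^ 2).
  assert (hrho : forall u, in_interval (Rbar_opp be) be u <-> in_interval a b (rho u)).
  { intros u.
    assert (hb : Rbar_lt (rho u) b).
    { destruct hr2 as [_ hb]. apply Rbar_le_lt_trans with (2 := hb).
      unfold rho. simpl. nra. }
    unfold be. destruct a as [a'| |].
    - destruct hr2 as [ha' _]. simpl in ha'.
      assert (hs := sqrt_sqrt (r2 - a')). assert (hs0 := sqrt_lt_R0 (r2 - a')).
      unfold in_interval; simpl. fold (rho u). unfold rho. simpl. split.
      + intros [h1 h2]. split; [nra | exact hb].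
      + intros [h1 _]. split; nra.
    - destruct hr2 as [[] _].
    - split; intros _; split; simpl; auto. }
  (* Energy conservation reads [2 * u^2 * g^2 = W r2 - W (rho u)], and the right side is [u^2] times
     the divided difference. At [u = 0] the latter is [dW r2], positive by hypothesis. *)
  set (g := fun u => sqrt (dd W (rho u) r2 / 2)).
  assert (hddp : forall u, in_interval (Rbar_opp be) be u -> 0 < dd W (rho u) r2).
  { intros u hu. apply hrho in hu. destruct (Req_dec u 0) as [-> | hn].
    - replace (rho 0) with r2 by (unfold rho; ring).
      rewrite dd_diag, (is_derive_unique _ _ _ (hW r2 hr2)). exact hd2.
    - assert (hr : rho u < r2) by (unfold rho; pose proof (pow2_gt_0 u hn); lra).
      specialize (hlt (rho u) hu hr). assert (hm := dd_mult W (rho u) r2). nra. }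
  assert (hgc : forall u, in_interval (Rbar_opp be) be u -> continuous g u).
  { intros u hu. apply hrho in hu.
    apply (continuous_comp (fun u => dd W (rho u) r2 / 2) sqrt); [| apply continuous_sqrt].
    apply (continuous_mult (fun u => dd W (rho u) r2) (fun _ => / 2));
      [| apply continuous_const].
    apply (continuous_comp rho (fun r => dd W r r2)).
    - apply (ex_derive_continuous rho). unfold rho. auto_derive. trivial.
    - apply dd_continuous_l. eexists. apply hW, hu. }
  assert (hgp : forall u, in_interval (Rbar_opp be) be u -> 0 < g u).
  { intros u hu. apply sqrt_lt_R0. specialize (hddp u hu). lra. }
  assert (hg2 : forall u, in_interval (Rbar_opp be) be u ->
            g u ^ 2 = dd W (rho u) r2 / 2).
  { intros u hu. unfold g. simpl. rewrite Rmult_1_r. apply sqrt_sqrt.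
    specialize (hddp u hu). lra. }
  assert (h0 : in_interval (Rbar_opp be) be 0).
  { apply hrho. replace (rho 0) with r2 by (unfold rho; ring). exact hr2. }
  destruct (autonomous_flow _ _ g 0 h0 hgc hgp) as (t0 & t1 & u & G & hG0 & hG & hu & hmon).
  exists t0, t1, (fun t => rho (u t)), (fun t => - 2 * u t * g (u t)), 0.
  destruct (hG 0 h0) as (_ & hin0 & hu0). rewrite hG0 in hin0, hu0.
  split; [exact hin0 | split; [| split]].
  - apply (radial_motion_of_energy (Rbar_opp be) be a b W dW rho (fun x => - 2 * x)
             (fun _ => - 2) g (W r2) t0 t1 u hW).
    + intros x hx. split; [apply hrho, hx |].
      split; [unfold rho; auto_derive; [trivial | ring] |].
      split; [auto_derive; [trivial | ring] |].
      split; [apply hgc, hx | split; [apply hgp, hx | split]].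
      * rewrite Rpow_mult_distr, (hg2 x hx).
        assert (hm := dd_mult W (rho x) r2). unfold rho in hm at 2.
        set (q := dd W (rho x) r2) in *.
        replace (r2 - x ^ 2 - r2) with (- x ^ 2) in hm by ring. 
        replace (W r2 - W (rho x)) with (- (W (rho x) - W r2)) by ring.
        rewrite hm. field.
      * intros hx0. rewrite (hg2 x hx). replace x with 0 by lra.
        replace (rho 0) with r2 by (unfold rho; ring).
        rewrite dd_diag, (is_derive_unique _ _ _ (hW r2 hr2)). field.
    + intros t ht. destruct (hu t ht) as (h1 & _ & h2). auto.
  (* Outside parameters [- w] and [w] the radius is below [x]. If [x > r2], then [sqrt] returns 0
     and the orbit never gets above [x] at all. *)
  - intros x y hx hy. set (w := sqrt (r2 - x)).
    assert (hw0 : 0 <= w) by apply sqrt_pos.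
    assert (hw2 : r2 - x <= w ^ 2).
    { destruct (Rle_or_lt 0 (r2 - x)) as [h | h].
      - right. unfold w. simpl. rewrite Rmult_1_r, sqrt_sqrt; trivial.
      - nra. }
    assert (hwin : in_interval (Rbar_opp be) be w).
    { apply hrho. unfold rho. destruct (Rle_or_lt 0 (r2 - x)) as [h | h].
      - replace (r2 - w ^ 2) with x; [exact hx |].
        unfold w. simpl. rewrite Rmult_1_r, sqrt_sqrt; trivial. ring.
      - replace w with 0 by (symmetry; apply sqrt_neg_0; lra).
        replace (r2 - 0 ^ 2) with r2 by ring. exact hr2. }
    assert (hwin' : in_interval (Rbar_opp be) be (- w)).
    { apply hrho. apply hrho in hwin. unfold rho in *.
      replace ((- w) ^ 2) with (w ^ 2) by ring. exact hwin. }
    exists (G (- w)), (G w).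
    split; [apply hG, hwin' | split; [apply hG, hwin |]].
    intros t ht hts hxy. unfold rho in hxy.
    destruct hts as [hts | hts].
    + apply (hmon (- w) t hwin' ht) in hts. nra.
    + apply (hmon w t hwin ht) in hts. nra.
  - intros t ht hts heq. rewrite hu0 in heq. unfold rho in heq.
    assert (0 < u t) by (apply (hmon 0 t h0 ht); lra). nra.
Qed.

(** At energy [M] there is no turning point, so [r] itself serves as parameter and increases through
    the whole interval. *)
Lemma monotone_escape (a b : Rbar) (W dW : R -> R) (M : R) :
  Rbar_lt a b ->
  (forall r, in_interval a b r -> is_derive W r (dW r)) ->
  (forall r, in_interval a b r -> W r < M) -> escaping a b dW.
Proof.
  intros hab hW hM. destruct (in_interval_nonempty a b hab) as [c hc].
  set (g := fun u => sqrt (2 * (M - W u))).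
  assert (hgc : forall u, in_interval a b u -> continuous g u).
  { intros u hu. apply (continuous_comp (fun u => 2 * (M - W u)) sqrt);
      [| apply continuous_sqrt].
    apply (ex_derive_continuous (fun u => 2 * (M - W u))). auto_derive.
    eexists. apply hW, hu. }
  assert (hgp : forall u, in_interval a b u -> 0 < g u).
  { intros u hu. apply sqrt_lt_R0. specialize (hM u hu). lra. }
  destruct (autonomous_flow a b g c hc hgc hgp)
    as (t0 & t1 & u & G & hG0 & hG & hu & hmon).
  exists t0, t1, u, (fun t => 1 * g (u t)), 0.
  destruct (hG c hc) as (_ & hin0 & hu0). rewrite hG0 in hin0, hu0.
  split; [exact hin0 | split; [| split]].
  - apply (radial_motion_of_energy a b a b W dW (fun x => x) (fun _ => 1)
             (fun _ => 0) g M t0 t1 u hW).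
    + intros x hx. split; [exact hx |].
      split; [apply @is_derive_id |].
      split; [apply @is_derive_const |].
      split; [apply hgc, hx | split; [apply hgp, hx | split; [| lra]]].
      rewrite Rmult_1_l. unfold g. simpl. rewrite Rmult_1_r, sqrt_sqrt; [field |].
      specialize (hM x hx). lra.
    + intros t ht. destruct (hu t ht) as (h1 & _ & h2). auto.
  - intros x y hx hy. exists (G x), (G y).
    split; [apply hG, hx | split; [apply hG, hy |]].
    intros t ht hts hxy. destruct hts as [hts | hts].
    + apply (hmon x t hx ht) in hts. lra.
    + apply (hmon y t hy ht) in hts. lra.
  - intros t ht hts. rewrite hu0.
    assert (c < u t) by (apply (hmon c t hc ht); lra). lra.
Qed.

(** If [W] exceeds [M] somewhere, this happens to the right of [c], and the first point where a
    regular level above [M] is reached reflects orbits coming from the left. Otherwise [W] is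
    bounded on the whole interval and an orbit of higher energy crosses it. *)
Lemma escaping_of_left_bound (a b : Rbar) (W dW : R -> R) (c M : R) :
  (forall r, in_interval a b r -> is_derive W r (dW r)) ->
  (forall r, in_interval a b r -> continuous dW r) ->
  in_interval a b c ->
  (forall r, in_interval a b r -> r <= c -> W r <= M) -> escaping a b dW.
Proof.
  intros hW hdW hc hM.
  assert (hab : Rbar_lt a b) by (apply Rbar_lt_trans with c; apply hc).
  destruct (classic (exists y, in_interval a b y /\ M < W y)) as [[y [hy hMy]] | hn].
  - assert (hcy : c < y).
    { apply Rnot_le_lt. intros h. specialize (hM y hy h). lra. }
    destruct (regular_value a b W dW c y M (W y) hW hdW hc hy hcy hMy)
      as (E & hE & hreg).
    destruct (first_crossing a b W c y E) as (z & hz & hWz & hlt); trivial; try lra.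
    { intros x hx. exact (is_derive_continuous W x _ (hW x hx)). }
    { split; [| lra]. specialize (hM c hc). lra. }
    assert (hzin : in_interval a b z) by (apply (in_interval_between a b c y); trivial; lra).
    assert (hltz : forall r, in_interval a b r -> r < z -> W r < W z).
    { intros r hr hrz. rewrite hWz. destruct (Rle_or_lt r c) as [h | h].
      - specialize (hM r hr h). lra.
      - apply hlt. lra. }
    apply (reflecting_escape a b W dW z hW hzin hltz).
    specialize (hreg z ltac:(lra) hWz).
    assert (0 <= dW z); [| lra].
    apply (nonneg_derive_of_left_max W z); [apply hW, hzin |].
    exists (z - c). split; [lra |]. intros r hr. rewrite hWz. left. apply hlt. lra.
  - apply (monotone_escape a b W dW (M + 1) hab hW).
    intros r hr. apply Rnot_le_lt. intros h. apply hn. exists r. split; [trivial | lra].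
Qed.

Lemma escaping_of_right_bound (a b : Rbar) (W dW : R -> R) (c M : R) :
  (forall r, in_interval a b r -> is_derive W r (dW r)) ->
  (forall r, in_interval a b r -> continuous dW r) ->
  in_interval a b c ->
  (forall r, in_interval a b r -> c <= r -> W r <= M) -> escaping a b dW.
Proof.
  intros hW hdW hc hM. apply escaping_opp.
  assert (hin : forall r, in_interval (Rbar_opp b) (Rbar_opp a) r -> in_interval a b (- r)).
  { intros r hr. apply in_interval_opp. rewrite Ropp_involutive. exact hr. }
  apply (escaping_of_left_bound _ _ (fun r => W (- r)) _ (- c) M).
  - intros r hr. auto_derive; [eexists; apply hW, hin, hr |].
    replace (Derive (fun x : R => W x) (- r)) with (dW (- r))
      by (symmetry; apply is_derive_unique, hW, hin, hr).
    ring.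
  - intros r hr. apply (continuous_opp (fun r => dW (- r))).
    apply (continuous_comp (fun y => - y) dW); [| apply hdW, hin, hr].
    apply (ex_derive_continuous (fun y => - y)). auto_derive. trivial.
  - apply in_interval_opp, hc.
  - intros r hr hrc. apply hM; [apply hin, hr | lra].
Qed.

(** * Oscillating orbits *)

Lemma cos_eq_1_inv (x : R) : cos x = 1 -> exists k : Z, x = 2 * PI * IZR k.
Proof.
  intros h. replace x with (2 * (x / 2)) in h by field. rewrite cos_2a_sin in h.
  destruct (sin_eq_0_0 (x / 2)) as [k hk]; [nra |].
  exists k. lra.
Qed.

(* The radial coordinate oscillates between [r1] and [s] as
   [r = r1 + (s - r1) / 2 * (1 - cos theta)] with [theta' = sqrt (2 h)]; the
   integral is the angle swept during one radial period. *)
Lemma closed_oscillation (a b : Rbar) (f V W h : R -> R) (K r1 s : R) :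
  (forall x, in_interval a b x -> f x <> 0) ->
  (forall x, in_interval a b x -> ex_derive f x) ->
  (forall x, in_interval a b x -> ex_derive V x) ->
  completely_closing a b f V -> K <> 0 ->
  (forall x, in_interval a b x -> is_derive W x (effective_force f V K x)) ->
  in_interval a b r1 -> in_interval a b s -> r1 < s ->
  (forall x, r1 <= x <= s -> continuous h x /\ 0 < h x) ->
  (forall x, W x = W r1 - (x - r1) * (s - x) * h x) ->
  let rho := fun th => r1 + (s - r1) / 2 * (1 - cos th) in
  exists (n : nat) (m : Z), (1 <= n)%nat /\
    INR n * RInt (fun th => K / f (rho th) ^ 2 / sqrt (2 * h (rho th))) 0 (2 * PI)
      = 2 * PI * IZR m.
Proof.
  intros hf0 hf hV hcc hK hW hr1 hs hlt hh hWh rho.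
  set (d := (s - r1) / 2). assert (hd : 0 < d) by (unfold d; lra).
  assert (hrho : forall th, r1 <= rho th <= s).
  { intros th. pose proof (COS_bound th). unfold rho. fold d. unfold d in *. nra. }
  assert (hrin : forall th, in_interval a b (rho th)).
  { intros th. apply (in_interval_between a b r1 s); auto. }
  assert (hdrho : forall th, is_derive rho th (d * sin th)).
  { intros th. unfold rho. fold d. auto_derive; [trivial | ring]. }
  (* Along [rho] the product [(x - r1) * (s - x)] equals [d^2 * sin^2], which is also the square of
     the derivative of [rho]. The energy equation thus reduces to [g^2 = 2 h], with no zero at the
     turning points. *)
  set (g := fun th => sqrt (2 * h (rho th))).
  assert (hgc : forall th, continuous g th).
  { intros th. apply (continuous_comp (fun th => 2 * h (rho th)) sqrt);
      [| apply continuous_sqrt].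
    apply (continuous_mult (fun _ => 2) (fun th => h (rho th))); [apply continuous_const |].
    apply (continuous_comp rho h); [exact (is_derive_continuous rho th _ (hdrho th)) |].
    apply hh, hrho. }
  assert (hgp : forall th, 0 < g th).
  { intros th. apply sqrt_lt_R0. pose proof (proj2 (hh _ (hrho th))). lra. }
  assert (hg2 : forall th, g th ^ 2 = 2 * h (rho th)).
  { intros th. unfold g. simpl. rewrite Rmult_1_r. apply sqrt_sqrt.
    pose proof (proj2 (hh _ (hrho th))). lra. }
  assert (hall : forall x, in_interval m_infty p_infty x) by (intros x; split; exact I).
  destruct (autonomous_flow m_infty p_infty g 0 (hall 0) (fun x _ => hgc x) (fun x _ => hgp x))
    as (t0 & t1 & u & G & hG0 & hG & hu & hmon).
  (* The angular speed is bounded by [M], so reaching [th] takes at least [Rabs th / M]; the times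
     [G th] are unbounded in both directions and the motion exists for all times. *)
  destruct (continuity_ab_maj h r1 s) as [xm [hxm _]]; [lra | |].
  { intros x hx. apply continuity_pt_filterlim, hh, hx. }
  set (M := sqrt (2 * h xm)).
  assert (hM : forall th, g th <= M).
  { intros th. apply sqrt_le_1_alt. specialize (hxm _ (hrho th)). lra. }
  assert (hMp : 0 < M) by (pose proof (hgp 0); pose proof (hM 0); lra).
  assert (hGy : forall y, exists q, / M <= q /\ G y = q * y).
  { intros y. destruct (mean_value m_infty p_infty G (fun x => / g x) 0 y)
      as [z [_ hz]]; auto.
    { intros x hx. apply hG, hx. }
    exists (/ g z). split; [apply Rinv_le_contravar; auto |].
    rewrite hG0 in hz. lra. }
  assert (ht1 : t1 = p_infty).
  { destruct t1 as [t| |]; trivial; exfalso.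
    - set (y := M * (Rabs t + 1)). destruct (hGy y) as [q [hq hGq]].
      destruct (hG y (hall y)) as (_ & [_ hin] & _). simpl in hin.
      assert (0 < y) by (unfold y; pose proof (Rabs_pos t); nra).
      assert (/ M * y <= q * y) by (apply Rmult_le_compat_r; lra).
      assert (/ M * y = Rabs t + 1) by (unfold y; field; lra).
      pose proof (Rle_abs t). lra.
    - destruct (hG 0 (hall 0)) as (_ & [_ []] & _). }
  assert (ht0 : t0 = m_infty).
  { destruct t0 as [t| |]; trivial; exfalso.
    - set (y := M * (Rabs t + 1)). destruct (hGy (- y)) as [q [hq hGq]].
      destruct (hG (- y) (hall (- y))) as (_ & [hin _] & _). simpl in hin.
      assert (0 < y) by (unfold y; pose proof (Rabs_pos t); nra).
      assert (/ M * y <= q * y) by (apply Rmult_le_compat_r; lra).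
      assert (/ M * y = Rabs t + 1) by (unfold y; field; lra).
      pose proof (Rle_abs (- t)). rewrite Rabs_Ropp in *. lra.
    - destruct (hG 0 (hall 0)) as (_ & [[] _] & _). }
  subst t0 t1.
  assert (hu0 : u 0 = 0).
  { destruct (hG 0 (hall 0)) as (_ & _ & hu0). rewrite hG0 in hu0. exact hu0. }
  set (Psi := fun th => K / f (rho th) ^ 2 / g th).
  assert (hPsi : forall th, continuous Psi th).
  { intros th. apply (continuous_mult (fun th => K / f (rho th) ^ 2) (fun th => / g th)).
    - apply (ex_derive_continuous (fun th => K / f (rho th) ^ 2)). auto_derive.
      repeat split; [apply hf, hrin | eexists; apply hdrho |].
      pose proof (hf0 _ (hrin th)). rewrite Rmult_1_r.
      apply Rmult_integral_contrapositive; split; trivial.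
    - apply (continuous_comp g Rinv); [apply hgc |]. apply continuous_Rinv.
      pose proof (hgp th). lra. }
  set (psi := RInt Psi 0).
  assert (hpsi : forall th, is_derive psi th (Psi th)).
  { intros th. apply (antiderivative_interval m_infty p_infty Psi 0); auto. }
  set (r := fun t => rho (u t)). set (phi := fun t => - psi (u t)).
  assert (hmot : radial_motion a b (effective_force f V K) m_infty p_infty r
                   (fun t => d * sin (u t) * g (u t))).
  { apply (radial_motion_of_energy m_infty p_infty a b W _ rho (fun th => d * sin th)
             (fun th => d * cos th) g (W r1) m_infty p_infty u hW).
    - intros th _. split; [apply hrin | split; [apply hdrho | split; [| split; [apply hgc |
        split; [apply hgp | split]]]]].
      + auto_derive; [trivial | ring].
      + rewrite Rpow_mult_distr, hg2, (hWh (rho th)).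
        assert (hcs := sin2_cos2 th). unfold Rsqr in hcs.
        set (hr := h (rho th)). unfold rho. unfold d.
        replace (((s - r1) / 2 * sin th) ^ 2) with (((s - r1) / 2) ^ 2 * (1 - cos th * cos th)).
        * field.
        * replace (1 - cos th * cos th) with (sin th * sin th) by lra. ring.
      (* At a turning point [W - W r1] is a product whose polynomial factor vanishes, so its
         derivative is known although [h] is only continuous. *)
      + intros hsin. assert (hsin' : sin th = 0) by nra. rewrite hg2.
        assert (hW' : forall x, in_interval a b x -> forall l, is_derive W x l ->
                  effective_force f V K x = l).
        { intros x hx l hl. rewrite <- (is_derive_unique _ _ _ (hW x hx)).
          apply is_derive_unique, hl. }
        assert (hcs := sin2_cos2 th). unfold Rsqr in hcs. rewrite hsin' in hcs.
        assert (hWh' : forall x, W r1 + (r1 - x) * (s - x) * h x = W x).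
        { intros x. rewrite (hWh x). ring. }
        assert (hc1 : cos th = 1 \/ cos th = -1).
        { assert (hz : (cos th - 1) * (cos th + 1) = 0) by nra.
          apply Rmult_integral in hz. destruct hz; [left | right]; lra. }
        destruct hc1 as [hc1 | hc1].
        * assert (hr : rho th = r1) by (unfold rho; rewrite hc1; ring). rewrite hr.
          assert (hder : is_derive (fun x => (r1 - x) * (s - x) * h x) r1
                           (- (s - r1) * h r1)).
          { apply (is_derive_mult_vanishing (fun x => (r1 - x) * (s - x)) h).
            - auto_derive; [trivial | ring].
            - ring.
            - apply hh. lra. }
          rewrite (hW' r1 hr1 (- (s - r1) * h r1)).
          { rewrite hc1. unfold d. field. }
          refine (is_derive_ext _ _ _ _ hWh' _).
          replace (- (s - r1) * h r1) with (plus 0 (- (s - r1) * h r1))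
            by (unfold plus; simpl; ring).
          apply (is_derive_plus (fun _ => W r1)); [apply @is_derive_const | exact hder].
        * assert (hr : rho th = s) by (unfold rho; rewrite hc1; field). rewrite hr.
          assert (hder : is_derive (fun x => (r1 - x) * (s - x) * h x) s
                           ((s - r1) * h s)).
          { apply (is_derive_mult_vanishing (fun x => (r1 - x) * (s - x)) h).
            - auto_derive; [trivial | ring].
            - ring.
            - apply hh. lra. }
          rewrite (hW' s hs ((s - r1) * h s)).
          { rewrite hc1. unfold d. field. }
          refine (is_derive_ext _ _ _ _ hWh' _).
          replace ((s - r1) * h s) with (plus 0 ((s - r1) * h s))
            by (unfold plus; simpl; ring).
          apply (is_derive_plus (fun _ => W r1)); [apply @is_derive_const | exact hder].
    - intros t ht. destruct (hu t ht) as (h1 & _ & h2). auto. }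
  assert (hphi : forall t, in_interval m_infty p_infty t ->
            is_derive phi t (- K / f (r t) ^ 2)).
  { intros t ht. destruct (hu t ht) as (_ & _ & hut).
    replace (- K / f (r t) ^ 2) with (opp (scal (g (u t)) (Psi (u t)))).
    - apply (is_derive_opp (fun t => psi (u t))).
      exact (is_derive_comp psi u t _ _ (hpsi _) hut).
    - unfold opp, scal; simpl. unfold mult; simpl. unfold Psi, r.
      pose proof (hgp (u t)). field. split; [apply hf0, hrin | lra]. }
  destruct (solution_of_radial_motion a b f V K m_infty p_infty r _ phi hf0 hf hV I hmot hphi)
    as [hsol hmom].
  destruct (hcc m_infty p_infty r phi (trajectory_of_global_solution _ _ _ _ _ _ hsol))
    as (_ & _ & T & hT & hper).
  { intros hsing. apply hK. rewrite <- (hmom 0 (hall 0)). apply hsing, hall. }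
  destruct (hper 0) as [hrT [m hm]]. rewrite Rplus_0_l in hrT, hm.
  assert (huT : 0 < u T) by (apply (hmon 0 T (hall 0) (hall T)); lra).
  (* At time 0 the radius is at its minimum [r1]. Being there again at time [T] forces
     [cos (u T) = 1]: the period consists of [k] complete radial oscillations. *)
  destruct (cos_eq_1_inv (u T)) as [k hk].
  { unfold r, rho in hrT. rewrite hu0, cos_0 in hrT. fold d in hrT. nra. }
  assert (hkp : (0 < k)%Z).
  { apply lt_IZR. pose proof PI_RGT_0. nra. }
  assert (hshift : forall th, psi (th + 2 * PI) - psi th = psi (2 * PI)).
  { intros th.
    assert (hpsi0 : psi 0 = 0) by (unfold psi; rewrite RInt_point; reflexivity).
    transitivity (psi (0 + 2 * PI) - psi 0).
    - apply (constant_of_derive m_infty p_infty (fun th => psi (th + 2 * PI) - psi th));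
        auto.
      intros z _.
      replace 0 with (minus (scal 1 (Psi (z + 2 * PI))) (Psi z)).
      + apply (is_derive_minus (fun th => psi (th + 2 * PI)) psi); [| apply hpsi].
        apply (is_derive_comp psi (fun th => th + 2 * PI)); [apply hpsi |].
        auto_derive; [trivial | ring].
      + unfold minus, plus, opp, scal; simpl. unfold mult; simpl.
        unfold Psi, g, rho.
        replace (cos (z + 2 * PI)) with (cos z); [ring |].
        rewrite cos_plus, cos_2PI, sin_2PI. ring.
    - rewrite hpsi0, Rplus_0_l. ring. }
  assert (hmult : forall n, psi (2 * PI * INR n) = INR n * psi (2 * PI)).
  { intros n. induction n as [| n IH].
    - simpl. rewrite Rmult_0_r, Rmult_0_l. unfold psi. rewrite RInt_point. reflexivity.
    - rewrite S_INR. replace (2 * PI * (INR n + 1)) with (2 * PI * INR n + 2 * PI) by ring.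
      specialize (hshift (2 * PI * INR n)). lra. }
  (* The sign comes from [phi = - psi (u t)]. *)
  exists (Z.to_nat k), (- m)%Z. split; [lia |].
  change (INR (Z.to_nat k) * psi (2 * PI) = 2 * PI * IZR (- m)).
  rewrite <- hmult, INR_IZR_INZ, Z2Nat.id, <- hk by lia.
  unfold phi in hm. rewrite hu0 in hm.
  assert (hpsi0 : psi 0 = 0) by (unfold psi; rewrite RInt_point; reflexivity).
  rewrite hpsi0 in hm. rewrite opp_IZR. lra.
Qed.

(** * Dependence on a parameter, and irrational values *)

(** By compactness [H 0] has a positive minimum, and uniform continuity keeps [H p] within less than
    this minimum of [H 0]. It makes the well persist for small moments. *)
Lemma positive_strip (H : R -> R -> R) (eta c d : R) :
  0 < eta -> c <= d ->
  (forall p th, Rabs p < eta -> continuous (fun z : R * R => H (fst z) (snd z)) (p, th)) ->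
  (forall th, c <= th <= d -> 0 < H 0 th) ->
  exists p0, 0 < p0 < eta /\ forall p th, Rabs p <= p0 -> c <= th <= d -> 0 < H p th.
Proof.
  intros heta hcd hH hpos.
  destruct (continuity_ab_min (H 0) c d hcd) as [tm [hmin htm]].
  { intros th hth. apply continuity_pt_filterlim.
    apply (continuous_comp_2 (fun _ => 0) (fun t => t) H).
    - apply continuous_const.
    - apply continuous_id.
    - apply hH. rewrite Rabs_R0. exact heta. }
  assert (hm := hpos tm htm).
  destruct (uniform_continuity_2d H (- (eta / 2)) (eta / 2) c d) with (eps := mkposreal _ hm)
    as [del hdel].
  { intros p th hp hth. apply continuity_2d_pt_filterlim. apply hH.
    apply Rabs_def1; lra. }
  simpl in hdel.
  exists (Rmin (eta / 2) (del / 2)). assert (hdp := cond_pos del).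
  assert (h1 : Rmin (eta / 2) (del / 2) <= eta / 2) by apply Rmin_l.
  assert (h2 : Rmin (eta / 2) (del / 2) <= del / 2) by apply Rmin_r.
  split; [split; [apply Rmin_glb_lt; lra | lra] |].
  intros p th hp hth.
  assert (hp1 : Rabs p <= eta / 2) by lra.
  assert (hd1 : Rabs (p - 0) < del) by (rewrite Rminus_0_r; lra).
  assert (hd2 : Rabs (th - th) < del) by (rewrite Rminus_diag, Rabs_R0; exact hdp).
  assert (h := hdel 0 th p th ltac:(lra) hth ltac:(apply Rabs_le_between in hp1; lra) hth hd1 hd2).
  apply Rabs_def2 in h. specialize (hmin th hth). lra.
Qed.

Lemma continuous_RInt_parameter (J : R -> R -> R) (p0 c d : R) :
  c < d ->
  (forall p th, Rabs p < p0 -> c <= th <= d ->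
     continuous (fun z : R * R => J (fst z) (snd z)) (p, th)) ->
  forall p, Rabs p < p0 -> continuous (fun p => RInt (J p) c d) p.
Proof.
  intros hcd hJ p hp. apply continuous_eps. intros eps he.
  (* Uniform continuity needs a closed rectangle, so the parameter is confined to [[- q, q]] with
     [q] strictly between [Rabs p] and [p0]. *)
  set (q := (Rabs p + p0) / 2). assert (hq : Rabs p < q < p0) by (unfold q; lra).
  assert (hex : forall p', Rabs p' < p0 -> ex_RInt (J p') c d).
  { intros p' hp'. apply (ex_RInt_continuous (J p')). intros th hth.
    rewrite Rmin_left, Rmax_right in hth by lra.
    apply (continuous_comp_2 (fun _ => p') (fun t => t) J).
    - apply continuous_const.
    - apply continuous_id.
    - apply hJ; trivial. }
  assert (he' : 0 < eps / (2 * (d - c))) by (apply Rdiv_lt_0_compat; lra).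
  destruct (uniform_continuity_2d J (- q) q c d) with (eps := mkposreal _ he')
    as [del hdel].
  { intros p' th hp' hth. apply continuity_2d_pt_filterlim. apply hJ; trivial.
    apply Rle_lt_trans with q; [apply Rabs_le; lra | lra]. }
  simpl in hdel. assert (hdp := cond_pos del).
  exists (Rmin del (q - Rabs p)). split; [apply Rmin_glb_lt; lra |].
  intros p' hp'.
  assert (h1 := Rlt_le_trans _ _ _ hp' (Rmin_l _ _)).
  assert (h2 := Rlt_le_trans _ _ _ hp' (Rmin_r _ _)).
  assert (hp'q : Rabs p' < q).
  { replace p' with (p + (p' - p)) by ring.
    eapply Rle_lt_trans; [apply Rabs_triang | lra]. }
  replace (RInt (J p') c d - RInt (J p) c d)
    with (RInt (fun th => minus (J p' th) (J p th)) c d)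
    by (apply (RInt_minus (J p') (J p)); apply hex; lra).
  apply Rle_lt_trans with ((d - c) * (eps / (2 * (d - c)))).
  - apply abs_RInt_le_const; [lra | apply (ex_RInt_minus (J p') (J p)); apply hex; lra |].
    intros th hth. left. apply hdel; trivial.
    + apply Rabs_le_between. lra.
    + apply Rabs_le_between. lra.
    + rewrite Rminus_diag, Rabs_R0. exact hdp.
  - replace ((d - c) * (eps / (2 * (d - c)))) with (eps / 2) by (field; lra). lra.
Qed.

Lemma sqrt2_irrational (p q : Z) : q <> 0%Z -> sqrt 2 * IZR q <> IZR p.
Proof.
  intros hq h.
  assert (hz : (2 * (q * q) = p * p)%Z).
  { apply eq_IZR. rewrite !mult_IZR, <- h.
    replace (sqrt 2 * IZR q * (sqrt 2 * IZR q))
      with (sqrt 2 * sqrt 2 * (IZR q * IZR q)) by ring.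
    rewrite sqrt_sqrt by lra. reflexivity. }
  (* Infinite descent: both numbers are even, and halving them gives a smaller solution. *)
  assert (hdesc : forall n : nat, forall p q : Z, (Z.abs_nat q <= n)%nat ->
            (2 * (q * q) = p * p)%Z -> q = 0%Z).
  { intros n. induction n as [| n IH]; intros p' q' hn he; [lia |].
    destruct (Z.Even_or_Odd p') as [[p1 ->] | [p1 ->]]; [| nia].
    destruct (Z.Even_or_Odd q') as [[q1 ->] | [q1 ->]]; [| nia].
    destruct (Z.eq_dec q1 0) as [-> | hq1]; [reflexivity |].
    assert (q1 = 0%Z) by (apply (IH p1 q1); [lia | nia]). lia. }
  apply hq, (hdesc (Z.abs_nat q) p q (Nat.le_refl _) hz).
Qed.

(** Provides the ratio of swept angle to full turn to be realised by an orbit: an irrational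
    multiple of [sqrt 2] would not be controlled, but [sqrt 2] divided by a large integer is
    irrational and small. *)
Lemma irrational_in_interval (c : R) :
  0 < c -> exists y, 0 < y < c /\
    forall (n : nat) (m : Z), (1 <= n)%nat -> INR n * y <> IZR m.
Proof.
  intros hc. assert (hs := sqrt_lt_R0 2 ltac:(lra)).
  destruct (nfloor_ex (sqrt 2 / c)) as [N [_ hN]].
  { apply Rlt_le, Rdiv_lt_0_compat; trivial. }
  rewrite <- S_INR in hN.
  assert (hNp : 0 < INR (S N)) by (apply lt_0_INR; lia).
  exists (sqrt 2 / INR (S N)). split.
  - split; [apply Rdiv_lt_0_compat; trivial |].
    apply Rmult_lt_reg_r with (INR (S N) / c); [apply Rdiv_lt_0_compat; trivial |].
    replace (sqrt 2 / INR (S N) * (INR (S N) / c)) with (sqrt 2 / c) by (field; lra).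
    replace (c * (INR (S N) / c)) with (INR (S N)) by (field; lra). exact hN.
  - intros n m hn heq.
    apply (sqrt2_irrational (m * Z.of_nat (S N)) (Z.of_nat n)); [lia |].
    rewrite mult_IZR, <- !INR_IZR_INZ, <- heq. field. lra.
Qed.

(* [r1] and [S p] are the turning points for the potential [V + k p * U], whose
   divided differences at [r1] are [V1 + k p * U1]. *)
Lemma turning_point_family (a b : Rbar) (V1 U1 : R -> R) (r1 s : R) :
  (forall x, in_interval a b x -> continuous V1 x) ->
  (forall x, in_interval a b x -> continuous U1 x) ->
  in_interval a b s -> r1 < s -> ex_derive V1 s -> V1 s = 0 -> 0 < Derive V1 s ->
  exists (S k : R -> R) (eta : R), 0 < eta /\ S 0 = s /\ k 0 = 0 /\
    (forall p, 0 < p < eta -> 0 < k p) /\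
    forall p, Rabs p < eta ->
      continuous S p /\ continuous k p /\ r1 < S p /\ in_interval a b (S p) /\
      V1 (S p) + k p * U1 (S p) = 0.
Proof.
  intros hV1 hU1 hs hlt hex h0 hpos.
  destruct (Req_dec (U1 s) 0) as [hU | hU].
  (* Here [s] remains a turning point for every strength [k] of the added potential. *)
  - exists (fun _ => s), (fun p => p), 1. split; [lra |].
    split; [trivial | split; [trivial | split; [intros p hp; lra |]]].
    intros p _. split; [apply continuous_const | split; [apply continuous_id |]].
    split; [exact hlt | split; [exact hs |]]. rewrite h0, hU. ring.
  (* The position of the turning point is prescribed and [k] is solved from an equation linear in
     it. To first order [V1 (S p)] is [- U1 s * p] times the positive slope of [V1], so moving by
     [- U1 s * p] makes [k p] positive for [p > 0]. *)
  - set (S := fun p => s - U1 s * p).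
    set (k := fun p => - V1 (S p) / U1 (S p)).
    assert (hS0 : S 0 = s) by (unfold S; ring).
    assert (hSc : forall p, continuous S p).
    { intros p. apply (ex_derive_continuous S). unfold S. auto_derive. trivial. }
    assert (hUs : 0 < U1 s * U1 s) by (apply Rsqr_pos_lt, hU).
    assert (hnear : locally s (fun x => in_interval a b x /\ r1 < x /\
              0 < dd V1 x s /\ 0 < U1 s * U1 x)).
    { apply filter_and; [apply in_interval_locally, hs |].
      apply filter_and; [apply (open_gt r1 s hlt) |].
      apply filter_and.
      - apply continuous_positive_locally; [apply dd_continuous_l, hex |].
        rewrite dd_diag. exact hpos.
      - apply (continuous_positive_locally (fun x => U1 s * U1 x)); [| exact hUs].
        apply (continuous_mult (fun _ => U1 s) U1); [apply continuous_const | apply hU1, hs]. }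
    rewrite <- hS0 in hnear.
    assert (hnear' := hSc 0 _ hnear). apply locally_Rabs in hnear'.
    destruct hnear' as (eta & heta & hloc). rewrite hS0 in hloc.
    assert (hloc' : forall p, Rabs p < eta -> in_interval a b (S p) /\ r1 < S p /\
              0 < dd V1 (S p) s /\ 0 < U1 s * U1 (S p)).
    { intros p hp. apply hloc. rewrite Rminus_0_r. exact hp. }
    assert (hne : forall p, Rabs p < eta -> U1 (S p) <> 0).
    { intros p hp e. destruct (hloc' p hp) as (_ & _ & _ & h). rewrite e in h. lra. }
    exists S, k, eta. split; [exact heta | split; [exact hS0 | split; [| split]]].
    + unfold k. rewrite hS0, h0. field. exact hU.
    + intros p hp.
      assert (hp' : Rabs p < eta) by (rewrite Rabs_right; lra).
      destruct (hloc' p hp') as (_ & _ & hq & hUU). specialize (hne p hp').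
      assert (hm := dd_mult V1 (S p) s). rewrite h0 in hm.
      set (q := dd V1 (S p) s) in *. unfold S in hm at 2.
      replace (k p) with (p * q * (U1 s * U1 (S p)) / (U1 (S p) * U1 (S p))).
      * apply Rdiv_lt_0_compat; [| apply Rsqr_pos_lt, hne].
        apply Rmult_lt_0_compat; [apply Rmult_lt_0_compat |]; lra.
      * unfold k. replace (- V1 (S p)) with (U1 s * p * q) by lra. field. exact hne.
    + intros p hp. destruct (hloc' p hp) as (hin & hr & _ & _). specialize (hne p hp).
      split; [apply hSc | split; [| split; [exact hr | split; [exact hin |]]]].
      * apply (continuous_mult (fun p => - V1 (S p)) (fun p => / U1 (S p))).
        -- apply (continuous_opp (fun p => V1 (S p))).
           apply (continuous_comp S V1); [apply hSc | apply hV1, hin].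
        -- apply (continuous_comp (fun p => U1 (S p)) Rinv).
           ++ apply (continuous_comp S U1); [apply hSc | apply hU1, hin].
           ++ apply continuous_Rinv, hne.
      * unfold k. field. exact hne.
Qed.

Lemma continuous_fst_comp (g : R -> R) (p th : R) :
  continuous g p -> continuous (fun z : R * R => g (fst z)) (p, th).
Proof. intros h. apply (continuous_comp fst g); [apply continuous_fst | exact h]. Qed.

(** For each small [p > 0] there is an oscillation between [r1] and [S p] with moment [sqrt (k p)];
    up to sign, [Phi p] is the angle swept in one radial period. It grows continuously away from
    [Phi 0 = 0], hence takes a value [2 * PI * w] with [w] irrational, which [closed_oscillation]
    excludes. *)
Lemma well_not_closing (a b : Rbar) (f V dV : R -> R) (r1 s : R) :
  (forall x, in_interval a b x -> f x <> 0) ->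
  (forall x, in_interval a b x -> ex_derive f x) ->
  (forall x, in_interval a b x -> continuous (Derive f) x) ->
  (forall x, in_interval a b x -> is_derive V x (dV x)) ->
  (forall x, in_interval a b x -> continuous dV x) ->
  in_interval a b r1 -> in_interval a b s -> r1 < s -> V s = V r1 ->
  (forall r, r1 < r < s -> V r < V r1) -> dV r1 < 0 -> 0 < dV s ->
  ~ completely_closing a b f V.
Proof.
  intros hf0 hf hdf hV hdV hr1 hs hlt hVs hwell hd1 hds hcc.
  set (U := fun x => - / (2 * f x ^ 2)). set (dU := fun x => Derive f x / f x ^ 3).
  assert (hfc : forall x, in_interval a b x -> continuous f x).
  { intros x hx. apply (ex_derive_continuous f x), hf, hx. }
  assert (hU : forall x, in_interval a b x -> is_derive U x (dU x)).
  { intros x hx. specialize (hf0 x hx). unfold U. auto_derive.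
    - split; [apply hf, hx | split; [| trivial]]. rewrite Rmult_1_r.
      repeat (apply Rmult_integral_contrapositive; split); lra.
    - replace (Derive (fun x0 : R => f x0) x) with (Derive f x) by reflexivity.
      unfold dU. field. exact hf0. }
  assert (hdU : forall x, in_interval a b x -> continuous dU x).
  { intros x hx. apply (continuous_mult (Derive f) (fun x => / f x ^ 3)); [apply hdf, hx |].
    apply (ex_derive_continuous (fun x => / f x ^ 3)). auto_derive.
    split; [apply hf, hx | split; [| trivial]]. specialize (hf0 x hx). rewrite Rmult_1_r.
    repeat (apply Rmult_integral_contrapositive; split); lra. }
  set (V1 := fun x => dd V x r1). set (U1 := fun x => dd U x r1).
  assert (hV1c : forall x, in_interval a b x -> continuous V1 x).
  { intros x hx. apply dd_continuous_l. eexists. apply hV, hx. }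
  assert (hU1c : forall x, in_interval a b x -> continuous U1 x).
  { intros x hx. apply dd_continuous_l. eexists. apply hU, hx. }
  assert (hV1r1 : V1 r1 < 0).
  { unfold V1. rewrite dd_diag, (is_derive_unique _ _ _ (hV r1 hr1)). exact hd1. }
  assert (hV1s : V1 s = 0).
  { unfold V1. rewrite dd_neq by lra. rewrite hVs. field. lra. }
  assert (hV1d : is_derive V1 s (dV s / (s - r1))).
  { assert (hn : s <> r1) by lra.
    apply (is_derive_ext_loc (fun y => (V y - V r1) / (y - r1))).
    - apply filter_imp with (2 := locally_neq s r1 hn).
      intros y hy. symmetry. apply dd_neq, hy.
    - auto_derive.
      + repeat split; [eexists; apply hV, hs | lra].
      + replace (Derive (fun x0 : R => V x0) s) with (dV s)
          by (symmetry; apply is_derive_unique, hV, hs).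
        rewrite hVs. field. lra. }
  assert (hV1dp : 0 < Derive V1 s).
  { rewrite (is_derive_unique _ _ _ hV1d). apply Rdiv_lt_0_compat; lra. }
  destruct (turning_point_family a b V1 U1 r1 s hV1c hU1c hs hlt (ex_intro _ _ hV1d) hV1s hV1dp)
    as (S & k & eta & heta & hS0 & hk0 & hkp & hfam).
  set (rho := fun p th => r1 + (S p - r1) / 2 * (1 - cos th)).
  (* The second divided difference of [V + k p * U] at [r1], [x] and [S p]: the quotient left after
     removing both turning points as factors. *)
  set (h := fun p x => dd V1 x (S p) + k p * dd U1 x (S p)).
  set (H := fun p th => h p (rho p th)).
  assert (hrho : forall p th, Rabs p < eta -> r1 <= rho p th <= S p).
  { intros p th hp. destruct (hfam p hp) as (_ & _ & hr & _).
    pose proof (COS_bound th). unfold rho. nra. }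
  assert (hrin : forall p x, Rabs p < eta -> r1 <= x <= S p -> in_interval a b x).
  { intros p x hp hx. destruct (hfam p hp) as (_ & _ & _ & hin & _).
    exact (in_interval_between a b r1 (S p) x hr1 hin hx). }
  assert (hrhoc : forall p th, Rabs p < eta ->
            continuous (fun z : R * R => rho (fst z) (snd z)) (p, th)).
  { intros p th hp. destruct (hfam p hp) as (hSc & _).
    apply (continuous_plus (fun _ : R * R => r1)
             (fun z : R * R => (S (fst z) - r1) / 2 * (1 - cos (snd z))));
      [apply continuous_const |].
    apply (continuous_mult (fun z : R * R => (S (fst z) - r1) / 2)
             (fun z : R * R => 1 - cos (snd z))).
    - apply (continuous_comp (fun z : R * R => S (fst z)) (fun x => (x - r1) / 2)).
      + apply continuous_fst_comp, hSc.
      + apply (ex_derive_continuous (fun x => (x - r1) / 2)). auto_derive. trivial.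
    - apply (continuous_comp snd (fun th => 1 - cos th)); [apply continuous_snd |].
      apply (ex_derive_continuous (fun th => 1 - cos th)). auto_derive. trivial. }
  assert (hddc : forall p x, Rabs p < eta -> r1 <= x <= S p ->
            continuous (fun z : R * R => dd V1 (fst z) (snd z)) (x, S p) /\
            continuous (fun z : R * R => dd U1 (fst z) (snd z)) (x, S p)).
  { intros p x hp hx. destruct (hfam p hp) as (_ & _ & hr & hin & _).
    assert (hxi := hrin p x hp hx). assert (hn : S p <> r1) by lra.
    split.
    - exact (dd_dd_continuous a b V dV r1 x (S p) hV hdV hxi hin hn).
    - exact (dd_dd_continuous a b U dU r1 x (S p) hU hdU hxi hin hn). }
  assert (hHc : forall p th, Rabs p < eta ->
            continuous (fun z : R * R => H (fst z) (snd z)) (p, th)).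
  { intros p th hp. destruct (hfam p hp) as (hSc & hkc & _).
    destruct (hddc p (rho p th) hp (hrho p th hp)) as [hA hB].
    apply (continuous_plus (fun z : R * R => dd V1 (rho (fst z) (snd z)) (S (fst z)))
             (fun z : R * R => k (fst z) * dd U1 (rho (fst z) (snd z)) (S (fst z)))).
    - apply (continuous_comp_2 (fun z : R * R => rho (fst z) (snd z))
               (fun z : R * R => S (fst z)) (dd V1)); [apply hrhoc, hp | | exact hA].
      apply continuous_fst_comp, hSc.
    - apply (continuous_mult (fun z : R * R => k (fst z))
               (fun z : R * R => dd U1 (rho (fst z) (snd z)) (S (fst z)))).
      + apply continuous_fst_comp, hkc.
      + apply (continuous_comp_2 (fun z : R * R => rho (fst z) (snd z))
                 (fun z : R * R => S (fst z)) (dd U1)); [apply hrhoc, hp | | exact hB].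
        apply continuous_fst_comp, hSc. }
  assert (h2PI : 0 < 2 * PI) by (pose proof PI_RGT_0; lra).
  assert (h00 : Rabs 0 < eta) by (rewrite Rabs_R0; exact heta).
  (* In the unperturbed well [V1] is negative on [[r1, s)], at [r1] because of the slope there, and
     zero at [s]; so its difference quotients towards [s] are positive. At [s] itself the strict
     slope of [V] is used. *)
  assert (hH0 : forall th, 0 < H 0 th).
  { intros th. unfold H, h. rewrite hk0, hS0, Rmult_0_l, Rplus_0_r.
    assert (hb := hrho 0 th h00). rewrite hS0 in hb. set (x := rho 0 th) in *.
    destruct (Req_dec x s) as [-> | hxs]; [rewrite dd_diag; exact hV1dp |].
    assert (hV1x : V1 x < 0).
    { destruct (Req_dec x r1) as [-> | hxr]; [exact hV1r1 |].
      assert (hm := dd_mult V x r1). fold (V1 x) in hm.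
      specialize (hwell x ltac:(lra)). nra. }
    assert (hm := dd_mult V1 x s). rewrite hV1s in hm. nra. }
  destruct (positive_strip H eta 0 (2 * PI) heta (Rlt_le _ _ h2PI) hHc (fun th _ => hH0 th))
    as (p0 & hp0 & hHp).
  (* For [p < 0] the value [k p] may be negative; [sqrt] is then 0, which keeps [J] continuous on
     both sides of [p = 0]. *)
  set (J := fun p th => sqrt (k p) / f (rho p th) ^ 2 / sqrt (2 * H p th)).
  assert (hJc : forall p th, Rabs p < p0 -> 0 <= th <= 2 * PI ->
            continuous (fun z : R * R => J (fst z) (snd z)) (p, th)).
  { intros p th hp hth. assert (hpe : Rabs p < eta) by lra.
    destruct (hfam p hpe) as (_ & hkc & _).
    assert (hri := hrin p _ hpe (hrho p th hpe)).
    specialize (hHp p th (Rlt_le _ _ hp) hth).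
    apply (continuous_mult (fun z : R * R => sqrt (k (fst z)) / f (rho (fst z) (snd z)) ^ 2)
             (fun z : R * R => / sqrt (2 * H (fst z) (snd z)))).
    - apply (continuous_mult (fun z : R * R => sqrt (k (fst z)))
               (fun z : R * R => / f (rho (fst z) (snd z)) ^ 2)).
      + apply (continuous_fst_comp (fun p => sqrt (k p))).
        apply (continuous_comp k sqrt); [exact hkc | apply continuous_sqrt].
      + apply (continuous_comp (fun z : R * R => rho (fst z) (snd z)) (fun x => / f x ^ 2));
          [apply hrhoc, hpe |].
        apply (ex_derive_continuous (fun x => / f x ^ 2)). auto_derive.
        split; [apply hf, hri | split; [| trivial]]. specialize (hf0 _ hri). simpl in *. rewrite Rmult_1_r.
        repeat (apply Rmult_integral_contrapositive; split); lra.
    - apply (continuous_comp (fun z : R * R => H (fst z) (snd z)) (fun x => / sqrt (2 * x)));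
        [apply hHc, hpe |].
      apply (ex_derive_continuous (fun x => / sqrt (2 * x))). simpl. auto_derive.
      split; [lra | split; [| trivial]].
      apply Rgt_not_eq, sqrt_lt_R0. lra. }
  set (Phi := fun p => RInt (J p) 0 (2 * PI)).
  assert (hPhic := continuous_RInt_parameter J p0 0 (2 * PI) h2PI hJc). fold Phi in hPhic.
  set (p1 := p0 / 2). assert (hp1 : 0 < p1 < p0) by (unfold p1; lra).
  assert (hPhi0 : Phi 0 = 0).
  { unfold Phi. transitivity (RInt (fun _ : R => 0) 0 (2 * PI)).
    - apply RInt_ext. intros th _. change (J 0 th = 0).
      unfold J. rewrite hk0, sqrt_0. unfold Rdiv. ring.
    - rewrite RInt_const. unfold scal; simpl; unfold mult; simpl. ring. }
  assert (hPhi1 : 0 < Phi p1).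
  { assert (hap1 : Rabs p1 < p0) by (rewrite Rabs_right; lra).
    apply RInt_gt_0; [exact h2PI | |].
    - intros th hth. assert (hpe : Rabs p1 < eta) by lra.
      assert (hH1 := hHp p1 th ltac:(lra) ltac:(lra)).
      assert (hf1 := hf0 _ (hrin p1 _ hpe (hrho p1 th hpe))).
      apply Rdiv_lt_0_compat; [apply Rdiv_lt_0_compat |].
      + apply sqrt_lt_R0, hkp. lra.
      + apply pow2_gt_0, hf1.
      + apply sqrt_lt_R0. lra.
    - intros th hth.
      apply (continuous_comp_2 (fun _ => p1) (fun t => t) J).
      + apply continuous_const.
      + apply continuous_id.
      + apply hJc; trivial. }
  destruct (irrational_in_interval (Phi p1 / (2 * PI))) as (w & hw & hirr).
  { apply Rdiv_lt_0_compat; trivial. }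
  assert (hw2 : Phi 0 < 2 * PI * w < Phi p1).
  { rewrite hPhi0. split; [apply Rmult_lt_0_compat; lra |].
    replace (Phi p1) with (2 * PI * (Phi p1 / (2 * PI))) by (field; lra).
    apply Rmult_lt_compat_l; lra. }
  (* The solution [p] lies strictly between 0 and [p1], so [k p > 0] and the moment is nonzero. *)
  destruct (ivt_interval (Finite (- p0)) (Finite p0) Phi 0 p1 (2 * PI * w))
    as (p & hp & hPhip).
  { intros z [hz1 hz2]. apply hPhic. simpl in hz1, hz2. apply Rabs_def1; lra. }
  { split; simpl; lra. }
  { split; simpl; lra. }
  { lra. }
  { left. exact hw2. }
  assert (hpa : Rabs p <= p0) by (rewrite Rabs_right; lra).
  assert (hpe : Rabs p < eta) by lra.
  assert (hkpp : 0 < k p) by (apply hkp; lra).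
  destruct (hfam p hpe) as (_ & _ & hr1S & hSin & hturn).
  destruct (closed_oscillation a b f V (fun x => V x + k p * U x) (h p) (sqrt (k p)) r1 (S p))
    as (n & m & hn & heq); trivial.
  - intros x hx. eexists. apply hV, hx.
  - apply Rgt_not_eq, sqrt_lt_R0, hkpp.
  - intros x hx. unfold effective_force.
    rewrite (is_derive_unique _ _ _ (hV x hx)).
    replace (sqrt (k p) ^ 2) with (k p) by (simpl; rewrite Rmult_1_r, sqrt_sqrt; lra).
    apply (is_derive_plus V (fun x => k p * U x)); [apply hV, hx |].
    apply (is_derive_scal U), hU, hx.
  - intros x hx. destruct (hddc p x hpe hx) as [hA hB]. split.
    + apply (continuous_plus (fun x => dd V1 x (S p)) (fun x => k p * dd U1 x (S p))).
      * apply (continuous_comp_2 (fun x => x) (fun _ => S p) (dd V1));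
          [apply continuous_id | apply continuous_const | exact hA].
      * apply (continuous_mult (fun _ => k p) (fun x => dd U1 x (S p)));
          [apply continuous_const |].
        apply (continuous_comp_2 (fun x => x) (fun _ => S p) (dd U1));
          [apply continuous_id | apply continuous_const | exact hB].
    (* Every radius between the turning points is [rho p th] with [th = acos c], so positivity of
       [H p] on [[0, 2 * PI]] carries over to [h p]. *)
    + set (c := 1 - 2 * (x - r1) / (S p - r1)).
      assert (hc : -1 <= c <= 1).
      { assert (hq : 0 <= (x - r1) / (S p - r1) <= 1).
        { split; [apply Rdiv_le_0_compat; lra |].
          apply Rmult_le_reg_r with (S p - r1); [lra |].
          replace ((x - r1) / (S p - r1) * (S p - r1)) with (x - r1) by (field; lra). lra. }
        unfold c. unfold Rdiv in *. lra. }
      assert (hx' : x = rho p (acos c)).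
      { unfold rho. rewrite cos_acos by exact hc. unfold c. field. lra. }
      rewrite hx'. apply (hHp p (acos c) hpa).
      pose proof (acos_bound c). pose proof PI_RGT_0. lra.
  (* Newton interpolation: two divided differences are split off, and the first-order one vanishes
     at [S p] by the choice of [k p]. *)
  - intros x. unfold h.
    assert (e1 := dd_mult V x r1). assert (e2 := dd_mult U x r1).
    assert (e3 := dd_mult V1 x (S p)). assert (e4 := dd_mult U1 x (S p)).
    fold (V1 x) in e1. fold (U1 x) in e2.
    set (A := dd V1 x (S p)) in *. set (B := dd U1 x (S p)) in *.
    transitivity (V r1 + k p * U r1 + ((V x - V r1) + k p * (U x - U r1))); [ring |].
    rewrite e1, e2.
    replace (V1 x) with (V1 (S p) + (x - S p) * A) by lra.
    replace (U1 x) with (U1 (S p) + (x - S p) * B) by lra.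
    replace (V1 (S p)) with (- (k p * U1 (S p))) by lra. ring.
  - apply (hirr n m hn).
    change (INR n * Phi p = 2 * PI * IZR m) in heq. rewrite hPhip in heq.
    apply Rmult_eq_reg_l with (2 * PI); lra.
Qed.

Theorem theorem3p1 (a b : Rbar) (hab : Rbar_lt a b) (f V : R -> R)
  (hf : smooth_on a b f)
  (hf0 : forall x : R, in_interval a b x -> f x <> 0)
  (hV : smooth_on a b V) :
  ~ completely_closing a b f V.
Proof.
  intros hcc.
  assert (hfd : forall x, in_interval a b x -> ex_derive f x) by exact (hf 1%nat).
  assert (hVd : forall x, in_interval a b x -> ex_derive V x) by exact (hV 1%nat).
  assert (hVD : forall x, in_interval a b x -> is_derive V x (Derive V x)).
  { intros x hx. apply Derive_correct, hVd, hx. }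
  assert (hdfc : forall x, in_interval a b x -> continuous (Derive f) x).
  { intros x hx. apply (ex_derive_continuous (Derive f) x), (hf 2%nat x hx). }
  assert (hdVc : forall x, in_interval a b x -> continuous (Derive V) x).
  { intros x hx. apply (ex_derive_continuous (Derive V) x), (hV 2%nat x hx). }
  assert (hwell : exists x c y, in_interval a b x /\ in_interval a b y /\ x < c < y /\
            V c < V x /\ V c < V y).
  (* Without a well, [V] cannot exceed [V c] on both sides of an arbitrary [c]. On a side where it
     does not, the effective potential [W] is bounded by [V c] too, being below [V]; the moment 1
     stands for any nonzero one. *)
  { apply NNPP. intros hn.
    destruct (in_interval_nonempty a b hab) as [c hc].
    apply (not_escaping a b f V 1 hf0 hfd hVd R1_neq_R0 hcc).
    set (W := fun x => V x - / (2 * f x ^ 2)).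
    assert (hW : forall x, in_interval a b x -> is_derive W x (effective_force f V 1 x)).
    { intros x hx. specialize (hf0 x hx). unfold W, effective_force. auto_derive.
      - split; [apply hVd, hx | split; [apply hfd, hx | split; [| trivial]]].
        rewrite Rmult_1_r.
        repeat (apply Rmult_integral_contrapositive; split); lra.
      - replace (Derive (fun x0 : R => f x0) x) with (Derive f x) by reflexivity.
        replace (Derive (fun x0 : R => V x0) x) with (Derive V x) by reflexivity.
        field. exact hf0. }
    assert (hdW : forall x, in_interval a b x -> continuous (effective_force f V 1) x).
    { intros x hx.
      apply (continuous_plus (Derive V) (fun x => 1 ^ 2 * (Derive f x / f x ^ 3)));
        [apply hdVc, hx |].
      apply (continuous_mult (fun _ => 1 ^ 2) (fun x => Derive f x / f x ^ 3));
        [apply continuous_const |].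
      apply (continuous_mult (Derive f) (fun x => / f x ^ 3)); [apply hdfc, hx |].
      apply (ex_derive_continuous (fun x => / f x ^ 3)). auto_derive.
      split; [apply hfd, hx | split; [| trivial]]. specialize (hf0 x hx). rewrite Rmult_1_r.
      repeat (apply Rmult_integral_contrapositive; split); lra. }
    assert (hWV : forall x, in_interval a b x -> W x <= V x).
    { intros x hx. unfold W.
      assert (0 < / (2 * f x ^ 2)); [| lra].
      apply Rinv_0_lt_compat. pose proof (pow2_gt_0 (f x) (hf0 x hx)). lra. }
    destruct (classic (exists x, in_interval a b x /\ x < c /\ V c < V x))
      as [(x & hx & hxc & hVx) | hl].
    - apply (escaping_of_right_bound a b W _ c (V c) hW hdW hc).
      intros y hy hcy. apply Rle_trans with (1 := hWV y hy). apply Rnot_lt_le.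
      intros hVy. destruct hcy as [hcy | <-]; [| lra].
      apply hn. exists x, c, y. auto.
    - apply (escaping_of_left_bound a b W _ c (V c) hW hdW hc).
      intros x hx hxc. apply Rle_trans with (1 := hWV x hx). apply Rnot_lt_le.
      intros hVx. destruct hxc as [hxc | ->]; [| lra].
      apply hl. exists x. auto. }
  destruct hwell as (x & c & y & hx & hy & hc & hcx & hcy).
  destruct (regular_well a b V (Derive V) x c y hVD hdVc hx hy hc hcx hcy)
    as (r1 & s & hr1 & hs & hlt & hVs & hlow & hd1 & hds).
  exact (well_not_closing a b f V (Derive V) r1 s hf0 hfd hdfc hVD hdVc
           hr1 hs hlt hVs hlow hd1 hds hcc).
Qed.
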